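(* Let $m\in\mathbb{Z}$ and let $L(m)$ be a link presented as the canonical closure of a braid (on $f\ge2$ strings) with corresponding braid group element $(\sigma_1)^m\in B_f$. Let $F_{L(m)}(r,s)\in\mathbb{C}(r,s)$ be its Kauffman link invariant and, for a positive integer $n$ and $q\in\mathbb{C}$ nonzero and not a root of unity, let $\Phi^{osp(1|2n)}_{L(m)}(q)$ and $\Phi^{so(2n+1)}_{L(m)}(-q)$ be its quantum link invariants associated with the $(2n+1)$-dimensional vector representations of $U_q(osp(1|2n))$ and $U_{-q}(so(2n+1))$. Then $$F_{L(m)}(-r,-s)=F_{L(m)}(r,s)\qquad\text{and}\qquad \Phi^{osp(1|2n)}_{L(m)}(q)=\Phi^{so(2n+1)}_{L(m)}(-q).$$
   Context: **Braid groups and link polynomials.** $B_f$ has generators $\sigma_1,\dots,\sigma_{f-1}$ with $\sigma_i\sigma_j=\sigma_j\sigma_i$ for $|i-j|>1$ and $\sigma_i\sigma_{i+1}\sigma_i=\sigma_{i+1}\sigma_i\sigma_{i+1}$. For $b=\sigma_{i_1}^{m_1}\cdots\sigma_{i_j}^{m_j}$ put $e(b)=\sum_k m_k$. If $\rho$ is a representation of $B_f$ and $\psi$ is a functional with $\psi(\rho(\theta\theta'))=\psi(\rho(\theta'\theta))$ for $\theta,\theta'\in B_f$, $\psi(\rho(\theta\sigma_{f-1}))=z\,\psi(\rho(\theta))$ and $\psi(\rho(\theta\sigma_{f-1}^{-1}))=\widetilde z\,\psi(\rho(\theta))$ for $\theta\in B_{f-1}$ (a Markov trace, with $z,\widetilde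 z\in\mathbb{C}$), then the associated link polynomial of the closure $L$ of $b\in B_f$ is $\widetilde F(L)=(z\widetilde z)^{-(f-1)/2}(\widetilde z/z)^{e(b)/2}\psi(\rho(b))$. **Roots.** Let $\epsilon_1,\dots,\epsilon_n$ be a basis of $H^*\cong\mathbb{C}^n$ with bilinear form $(\epsilon_i,\epsilon_j)=\delta_{ij}$; $\alpha_i=\epsilon_i-\epsilon_{i+1}$ for $i<n$, $\alpha_n=\epsilon_n$; $a_{ij}=2(\alpha_i,\alpha_j)/(\alpha_i,\alpha_i)$; $2\rho=\sum_{i=1}^n(2n-2i+1)\epsilon_i$. **$U_q(osp(1|2n))$** is the $\mathbb{Z}_2$-graded algebra generated by $e_i,f_i,k_i^{\pm1}$ ($1\le i\le n$), all even except $e_n,f_n$, which are odd, with relations: $k_i^{\pm1}$ commute and $k_ik_i^{-1}=1$; $k_ie_jk_i^{-1}=q^{(\alpha_i,\alpha_j)}e_j$; $k_if_jk_i^{-1}=q^{-(\alpha_i,\alpha_j)}f_j$; $e_if_j-(-1)^{[e_i][f_j]}f_je_i=\delta_{ij}\frac{k_i-k_i^{-1}}{q-q^{-1}}$; and the quantum Serre relations $(\mathrm{ad}\,e_i)^{1-a_{ij}}(e_j)=0=(\mathrm{ad}\,f_i)^{1-a_{ij}}(f_j)$ for $i\ne j$, where $(\mathrm{ad}\,e_i)(y)=e_iy-(-1)^{[e_i][y]}q^{(\alpha_i,\mathrm{wt}\,y)}ye_i$ and $(\mathrm{ad}\,f_i)(y)=f_iy-(-1)^{[f_i][y]}q^{(-\alpha_i,\mathrm{wt}\,y)}yf_i$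 for homogeneous weight elements $y$. Co-multiplication: $\Delta(e_i)=e_i\otimes k_i+1\otimes e_i$, $\Delta(f_i)=f_i\otimes1+k_i^{-1}\otimes f_i$, $\Delta(k_i^{\pm1})=k_i^{\pm1}\otimes k_i^{\pm1}$; tensor products are multiplied by $(a\otimes b)(x\otimes y)=(-1)^{[b][x]}ax\otimes by$. **$U_{p}(so(2n+1))$** (used with $p=-q$) is generated by $E_i,F_i,K_i^{\pm1}$ with the same relations and co-multiplication, with $q$ replaced by $p$, all generators even and all signs $(-1)^{[\cdot][\cdot]}$ omitted. **Vector representation.** $V$ denotes the $(2n+1)$-dimensional irreducible module with highest weight $\epsilon_1$ of either algebra (a vector $v$ has weight $\mu$ if $k_iv=q^{(\alpha_i,\mu)}v$, respectively $K_iv=(-q)^{(\alpha_i,\mu)}v$); as a $U_q(osp(1|2n))$-module its highest weight vector is taken to be odd. In both cases $V\otimes V=V_{2\epsilon_1}\oplus V_{\mu}\oplus V_0$, with $V_\lambda$ the irreducible submodule of highest weight $\lambda$, where $\mu=\epsilon_1+\epsilon_2$ if $n\ge2$ and $\mu=\epsilon_1$ if $n=1$. **Braid generators.** $\check R^{A}_{VV}$, $A\in\{so(2n+1),osp(1|2n)\}$, is $P\circ R^A_{VV}$, where $P$ is the (graded, in the $osp$ case) permutation and $R^A_{VV}$ is the $R$-matrix of $V\otimes V$, satisfying $R^A_{VV}\Delta(x)=(P\circ\Delta)(x)R^A_{VV}$ on $V\otimes V$. It commutes with the quantum (super)algebra and acts on $V_{2\epsilon_1},V_\mu,V_0$ by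 the scalars $-q,\ q^{-1},\ q^{-2n}$ respectively (for both $A=osp(1|2n)$ over $U_q$ and $A=so(2n+1)$ over $U_{-q}$). The braid group $B_f$ acts on $V^{\otimes f}$ by $\sigma_i^{\pm1}\mapsto \mathrm{id}^{\otimes(i-1)}\otimes(\check R^A_{VV})^{\pm1}\otimes\mathrm{id}^{\otimes(f-i-1)}$. **Markov traces.** $\mathrm{str}_q(X)=\mathrm{str}(k_{2\rho}\circ X)$ and $\mathrm{tr}_{-q}(X)=\mathrm{tr}(K_{2\rho}\circ X)$, where $\mathrm{str}$ is the supertrace, $\mathrm{tr}$ the trace, and $k_{2\rho}$ (resp. $K_{2\rho}$) is the product of the $k_i$ (resp. $K_i$) with $k_{2\rho}e_ik_{2\rho}^{-1}=q^{(2\rho,\alpha_i)}e_i$ (resp. $K_{2\rho}E_iK_{2\rho}^{-1}=(-q)^{(2\rho,\alpha_i)}E_i$) for all $i$. Put $\mathrm{sdim}_q(V)=\mathrm{str}_q(\mathrm{id}_V)$, $\dim_{-q}(V)=\mathrm{tr}_{-q}(\mathrm{id}_V)$; both equal $D:=\frac{-q^{2n}+q^{-2n}}{q-q^{-1}}+1$. On the algebras generated by the images of the $\sigma_i^{\pm1}$ in $\mathrm{End}(V^{\otimes f})$, $\psi^{so(2n+1)}(X)=\mathrm{tr}_{-q}(X)/D^f$ and $\psi^{osp(1|2n)}(X)=\mathrm{str}_q(X)/D^f$ are Markov traces with $z=q^{2n}/D$, $\widetilde z=q^{-2n}/D$. $\Phi^{so(2n+1)}_L(-q)$ and $\Phi^{osp(1|2n)}_L(q)$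 are the corresponding link polynomials $\widetilde F(L)$, with the square roots $(z\widetilde z)^{-1/2}=D$ and $(\widetilde z/z)^{1/2}=q^{-2n}$. **Kauffman invariant.** For $f\ge2$, the Birman--Wenzl--Murakami algebra $BWM_f$ over $\mathbb{C}(r,s)$ ($r,s$ indeterminates) is generated by invertible $g_1,\dots,g_{f-1}$ with $g_ig_j=g_jg_i$ ($|i-j|>1$), $g_ig_{i+1}g_i=g_{i+1}g_ig_{i+1}$, $e_ig_i=r^{-1}e_i$, $e_ig_{i-1}^{\pm1}e_i=r^{\pm1}e_i$ (for $i\ge2$), where $e_i$ is defined by $(s-s^{-1})(1-e_i)=g_i-g_i^{-1}$ ($BWM_1=\mathbb{C}(r,s)$). Put $x=\frac{r-r^{-1}}{s-s^{-1}}+1$. There is a linear functional $\mathrm{tr}$ on $BWM_f$ with $\mathrm{tr}(1)=1$, $\mathrm{tr}(ab)=\mathrm{tr}(ba)$, $\mathrm{tr}(e_i)=1/x$, $\mathrm{tr}(g_i^{\pm1})=r^{\pm1}/x$, and $\mathrm{tr}(a\chi b)=\mathrm{tr}(\chi)\mathrm{tr}(ab)$ for $a,b\in BWM_{f-1}$, $\chi\in\{g_{f-1},e_{f-1}\}$. If $L$ is the closure of $b\in B_f$ and $\beta\in BWM_f$ is the image of $b$ under $\sigma_i^{\pm1}\mapsto g_i^{\pm1}$, then with $\widehat{\mathrm{tr}}(b)=r^{-e(b)}\mathrm{tr}(\beta)$ the Kauffman invariant is $F_L(r,s)=\widehat{\mathrm{tr}}(\sigma_1)^{1-f}\,\widehat{\mathrm{tr}}(b)=x^{f-1}r^{-e(b)}\mathrm{tr}(\beta)$.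 $F_L(-r,-s)$ denotes the result of substituting $(r,s)\mapsto(-r,-s)$ (equivalently, the invariant defined from the algebra with parameters $-r,-s$). *)

(* Defs.v *)
From HB Require Import structures.
From mathcomp Require Import all_boot all_order all_algebra.
From mathcomp Require Import boolp reals.
From mathcomp.real_closed Require Import complex mxtens.
From mathcomp Require Import mpoly.

Set Implicit Arguments.
Unset Strict Implicit.
Unset Printing Implicit Defensive.

Import Order.TTheory GRing.Theory Num.Theory.
Local Open Scope ring_scope.
Local Open Scope quotient_scope.

(* An element of B_f is given by a word in the sigma_i^{+-1}: the letter
   (i, false) is sigma_{i+1} and (i, true) is its inverse. *)
Definition braid (f : nat) := seq ('I_f.-1 * bool).

Definition exp_sum (f : nat) (b : braid f) : int :=
  \sum_(l <- b) (-1) ^+ l.2.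

Lemma sigma1_subproof (f : nat) : (1 < f)%N -> (0 < f.-1)%N.
Proof. by case: f => [|[]]. Qed.

Definition sigma1 (f : nat) (hf : (1 < f)%N) : 'I_f.-1 :=
  Ordinal (sigma1_subproof hf).

Definition sigma1_pow (f : nat) (hf : (1 < f)%N) (m : int) : braid f :=
  nseq `|m|%N (sigma1 hf, m < 0).

Definition braid_image (f : nat) (A : pzRingType) (g gV : 'I_f.-1 -> A)
    (b : braid f) : A :=
  \prod_(l <- b) (if l.2 then gV l.1 else g l.1).

Inductive term (K X : Type) : Type :=
| Gen of X
| Scal of K
| Add of term K X & term K X
| Mul of term K X & term K X.

Arguments Gen {K X}.
Arguments Scal {K X}.

HB.instance Definition _ (K X : Type) := gen_eqMixin (term K X).
HB.instance Definition _ (K X : Type) := gen_choiceMixin (term K X).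

Section Presented.
Variables (K : fieldType) (X : Type).
Variable relator : term K X -> term K X -> Prop.

Definition Opp (t : term K X) := Mul (Scal (-1)) t.

Inductive cong : term K X -> term K X -> Prop :=
| cong_rel t u : relator t u -> cong t u
| cong_refl t : cong t t
| cong_sym t u : cong t u -> cong u t
| cong_trans t u v : cong t u -> cong u v -> cong t v
| cong_add t t' u u' : cong t t' -> cong u u' -> cong (Add t u) (Add t' u')
| cong_mul t t' u u' : cong t t' -> cong u u' -> cong (Mul t u) (Mul t' u')
| cong_addA t u v : cong (Add t (Add u v)) (Add (Add t u) v)
| cong_addC t u : cong (Add t u) (Add u t)
| cong_add0 t : cong (Add (Scal 0) t) t
| cong_addN t : cong (Add (Opp t) t) (Scal 0)
| cong_mulA t u v : cong (Mul t (Mul u v)) (Mul (Mul t u) v)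
| cong_mul1l t : cong (Mul (Scal 1) t) t
| cong_mul1r t : cong (Mul t (Scal 1)) t
| cong_mulDl t u v : cong (Mul (Add t u) v) (Add (Mul t v) (Mul u v))
| cong_mulDr t u v : cong (Mul t (Add u v)) (Add (Mul t u) (Mul t v))
| cong_scalD a b : cong (Scal (a + b)) (Add (Scal a) (Scal b))
| cong_scalM a b : cong (Scal (a * b)) (Mul (Scal a) (Scal b))
| cong_scalC a t : cong (Mul (Scal a) t) (Mul t (Scal a)).

Definition congb : rel (term K X) := fun t u => `[< cong t u >].

Lemma congb_equiv : equiv_class_of congb.
Proof.
split.
- by move=> t; apply/asboolP; constructor.
- by move=> t u; apply/asboolP/asboolP; apply: cong_sym.
- move=> u t v /asboolP tu /asboolP uv; apply/asboolP.
  exact: cong_trans tu uv.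
Qed.

Canonical congb_equivRel := EquivRelPack congb_equiv.

Definition presented := {eq_quot congb}.

HB.instance Definition _ := Choice.on presented.
HB.instance Definition _ : EqQuotient _ congb presented :=
  EqQuotient.on presented.

Lemma presentedP t u : cong t u <-> \pi_presented t = \pi_presented u.
Proof.
by split=> [h|/eqmodP/asboolP//]; apply/eqmodP/asboolP.
Qed.

Lemma cong_repr t : cong (repr (\pi_presented t)) t.
Proof. by apply/presentedP; rewrite reprK. Qed.

Definition padd (x y : presented) := \pi_presented (Add (repr x) (repr y)).
Definition pmul (x y : presented) := \pi_presented (Mul (repr x) (repr y)).
Definition popp (x : presented) := \pi_presented (Opp (repr x)).
Definition pscal (a : K) : presented := \pi_presented (Scal a).

Lemma paddE t u : padd (\pi_presented t) (\pi_presented u) = \pi_presented (Add t u).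
Proof. by apply/presentedP/cong_add; apply: cong_repr. Qed.

Lemma pmulE t u : pmul (\pi_presented t) (\pi_presented u) = \pi_presented (Mul t u).
Proof. by apply/presentedP/cong_mul; apply: cong_repr. Qed.

Lemma poppE t : popp (\pi_presented t) = \pi_presented (Opp t).
Proof.
by apply/presentedP/cong_mul; [apply: cong_refl | apply: cong_repr].
Qed.

Lemma paddA : associative padd.
Proof.
elim/quotW=> t; elim/quotW=> u; elim/quotW=> v.
rewrite (paddE u v) (paddE t (Add u v)) (paddE t u) (paddE (Add t u) v).
exact/presentedP/cong_addA.
Qed.

Lemma paddC : commutative padd.
Proof.
by elim/quotW=> t; elim/quotW=> u; rewrite (paddE t u) (paddE u t);
  apply/presentedP/cong_addC.
Qed.

Lemma padd0 : left_id (pscal 0) padd.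
Proof. by elim/quotW=> t; rewrite paddE; apply/presentedP/cong_add0. Qed.

Lemma paddN : left_inverse (pscal 0) popp padd.
Proof. by elim/quotW=> t; rewrite poppE (paddE (Opp t) t);
  apply/presentedP/cong_addN. Qed.

HB.instance Definition _ :=
  GRing.isZmodule.Build presented paddA paddC padd0 paddN.

Lemma pmulA : associative pmul.
Proof.
elim/quotW=> t; elim/quotW=> u; elim/quotW=> v.
rewrite (pmulE u v) (pmulE t (Mul u v)) (pmulE t u) (pmulE (Mul t u) v).
exact/presentedP/cong_mulA.
Qed.

Lemma pmul1l : left_id (pscal 1) pmul.
Proof. by elim/quotW=> t; rewrite pmulE; apply/presentedP/cong_mul1l. Qed.

Lemma pmul1r : right_id (pscal 1) pmul.
Proof. by elim/quotW=> t; rewrite pmulE; apply/presentedP/cong_mul1r. Qed.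

Lemma pmulDl : left_distributive pmul +%R.
Proof.
elim/quotW=> t; elim/quotW=> u; elim/quotW=> v.
rewrite /GRing.add /= (paddE t u) (pmulE (Add t u) v) (pmulE t v) (pmulE u v).
by rewrite (paddE (Mul t v)); apply/presentedP/cong_mulDl.
Qed.

Lemma pmulDr : right_distributive pmul +%R.
Proof.
elim/quotW=> t; elim/quotW=> u; elim/quotW=> v.
rewrite /GRing.add /= (paddE u v) (pmulE t (Add u v)) (pmulE t u) (pmulE t v).
by rewrite (paddE (Mul t u)); apply/presentedP/cong_mulDr.
Qed.

HB.instance Definition _ := GRing.Zmodule_isPzRing.Build presented
  pmulA pmul1l pmul1r pmulDl pmulDr.

Lemma pscalD a b : pscal (a + b) = pscal a + pscal b.
Proof. by rewrite /GRing.add /= paddE; apply/presentedP/cong_scalD. Qed.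

Lemma pscalM a b : pscal (a * b) = pscal a * pscal b.
Proof. by rewrite /GRing.mul /= pmulE; apply/presentedP/cong_scalM. Qed.

Lemma pscalC a (x : presented) : pscal a * x = x * pscal a.
Proof.
elim/quotW: x => t; rewrite /GRing.mul /= !pmulE.
exact/presentedP/cong_scalC.
Qed.

Definition pscale (a : K) (x : presented) : presented := pscal a * x.

Lemma pscaleA a b x : pscale a (pscale b x) = pscale (a * b) x.
Proof. by rewrite /pscale pscalM mulrA. Qed.

Lemma pscale1 : left_id 1 pscale.
Proof. by move=> x; rewrite /pscale mul1r. Qed.

Lemma pscaleDr : right_distributive pscale +%R.
Proof. by move=> a x y; rewrite /pscale mulrDr. Qed.

Lemma pscaleDl x : {morph pscale^~ x : a b / a + b}.
Proof. by move=> a b; rewrite /pscale pscalD mulrDl. Qed.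

HB.instance Definition _ := GRing.Zmodule_isLmodule.Build K presented
  pscaleA pscale1 pscaleDr pscaleDl.

Definition pgen (x : X) : presented := \pi_presented (Gen x).

End Presented.

Section Kauffman.
Variable R : realType.

Definition Crs := {fraction {mpoly R[i][2]}}.

Definition par_r : Crs := tofrac ('X_ord0 : {mpoly R[i][2]}).
Definition par_s : Crs := tofrac ('X_ord_max : {mpoly R[i][2]}).

Definition mpoly_neg_vars (p : {mpoly R[i][2]}) : {mpoly R[i][2]} :=
  p \mPo [tuple - 'X_j | j < 2].

(* Substituting - r, - s in a numerator and a denominator of x; the result does
   not depend on the representative. *)
Definition neg_params (x : Crs) : Crs :=
  tofrac (mpoly_neg_vars \n_(repr x)) / tofrac (mpoly_neg_vars \d_(repr x)).

Definition par_x : Crs :=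
  (par_r - par_r^-1) / (par_s - par_s^-1) + 1.

Section BWM.
Variable f : nat.

Definition tG (l : 'I_f.-1 * bool) : term Crs ('I_f.-1 * bool) := Gen l.
Definition tE (i : 'I_f.-1) : term Crs ('I_f.-1 * bool) :=
  Add (Scal 1)
    (Mul (Scal (- (par_s - par_s^-1)^-1))
       (Add (tG (i, false)) (Opp (tG (i, true))))).

(* Generators (i, false) and (i, true) stand for g_{i+1} and its inverse. *)
Inductive bwm_rel :
  term Crs ('I_f.-1 * bool) -> term Crs ('I_f.-1 * bool) -> Prop :=
| bwm_inv (i : 'I_f.-1) (e : bool) : bwm_rel (Mul (tG (i, e)) (tG (i, ~~ e))) (Scal 1)
| bwm_far (i j : 'I_f.-1) : (i.+1 < j)%N ->
    bwm_rel (Mul (tG (i, false)) (tG (j, false)))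
            (Mul (tG (j, false)) (tG (i, false)))
| bwm_braid (i j : 'I_f.-1) : j = i.+1 :> nat ->
    bwm_rel (Mul (Mul (tG (i, false)) (tG (j, false))) (tG (i, false)))
            (Mul (Mul (tG (j, false)) (tG (i, false))) (tG (j, false)))
| bwm_eg (i : 'I_f.-1) :
    bwm_rel (Mul (tE i) (tG (i, false))) (Mul (Scal par_r^-1) (tE i))
| bwm_ege (i j : 'I_f.-1) (e : bool) : j = i.+1 :> nat ->
    bwm_rel (Mul (Mul (tE j) (tG (i, e))) (tE j))
            (Mul (Scal (par_r ^ ((-1) ^+ e))) (tE j)).

Definition BWM := presented bwm_rel.
HB.instance Definition _ := GRing.PzRing.on BWM.
HB.instance Definition _ := GRing.Lmodule.on BWM.

(* BWM_f is non-trivial: g_i |-> s, e_i |-> 0 is a one-dimensional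
   representation. *)
Fixpoint bwm_eval (t : term Crs ('I_f.-1 * bool)) : Crs :=
  match t with
  | Gen l => if l.2 then par_s^-1 else par_s
  | Scal c => c
  | Add t u => bwm_eval t + bwm_eval u
  | Mul t u => bwm_eval t * bwm_eval u
  end.

Lemma par_s_neq0 : par_s != 0.
Proof.
rewrite tofrac_eq0; apply/eqP => /(congr1 (mcoeff U_(ord_max))).
by rewrite mcoeffX eqxx mcoeff0 => /eqP; rewrite oner_eq0.
Qed.

Lemma par_s_subV_neq0 : par_s - par_s^-1 != 0.
Proof.
apply/eqP => h.
have /eqP : par_s * (par_s - par_s^-1) = 0 by rewrite h mulr0.
rewrite mulrBr mulfV ?par_s_neq0 // /par_s -tofracM -tofrac1 -tofracB.
rewrite tofrac_eq0 => /eqP /(congr1 (mcoeff 0%MM)).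
rewrite mcoeffB mcoeff0 -mpolyXD mcoeffX mcoeff1 eqxx.
case: eqP => [/mnmP /(_ ord_max)|_ /eqP]; last first.
  by rewrite sub0r oppr_eq0 oner_eq0.
by rewrite mnmDE mnm1E mnm0E eqxx.
Qed.

Lemma bwm_eval_E i : bwm_eval (tE i) = 0.
Proof.
by rewrite /= mulN1r mulNr mulVf ?subrr // par_s_subV_neq0.
Qed.

Lemma bwm_evalP t u : cong bwm_rel t u -> bwm_eval t = bwm_eval u.
Proof.
elim=> {t u} //=.
- move=> t u [].
  + by move=> i [] /=; rewrite ?mulVf ?mulfV ?par_s_neq0.
  + by move=> i j _ /=; rewrite mulrC.
  + by [].
  + by move=> i; rewrite /bwm_eval -/bwm_eval bwm_eval_E mul0r mulr0.
  + by move=> i j e _; rewrite /bwm_eval -/bwm_eval bwm_eval_E !mulr0.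
- by move=> t u v _ -> _ ->.
- by move=> t t' u u' _ -> _ ->.
- by move=> t t' u u' _ -> _ ->.
- by move=> t u v; rewrite addrA.
- by move=> t u; rewrite addrC.
- by move=> t; rewrite add0r.
- by move=> t; rewrite mulN1r addNr.
- by move=> t u v; rewrite mulrA.
- by move=> t; rewrite mul1r.
- by move=> t; rewrite mulr1.
- by move=> t u v; rewrite mulrDl.
- by move=> t u v; rewrite mulrDr.
- by move=> a t; rewrite mulrC.
Qed.

Lemma BWM_oner_neq0 : (1 : BWM) != 0.
Proof.
apply/eqP => h.
have /presentedP /bwm_evalP /= : pscal bwm_rel 1 = pscal bwm_rel 0 by exact: h.
by move/eqP; rewrite oner_eq0.
Qed.

HB.instance Definition _ := GRing.PzSemiRing_isNonZero.Build BWM BWM_oner_neq0.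

Lemma BWM_scalerAl (a : Crs) (x y : BWM) : a *: (x * y) = (a *: x) * y.
Proof. exact: mulrA. Qed.

HB.instance Definition _ :=
  GRing.Lmodule_isLalgebra.Build Crs BWM BWM_scalerAl.

Lemma BWM_scalerAr (a : Crs) (x y : BWM) : a *: (x * y) = x * (a *: y).
Proof.
rewrite [LHS]mulrA [RHS]mulrA; congr (_ * y); exact: pscalC.
Qed.

HB.instance Definition _ :=
  GRing.Lalgebra_isAlgebra.Build Crs BWM BWM_scalerAr.

Definition bwm_g (i : 'I_f.-1) : BWM := pgen bwm_rel (i, false).
Definition bwm_gV (i : 'I_f.-1) : BWM := pgen bwm_rel (i, true).
Definition bwm_e (i : 'I_f.-1) : BWM :=
  1 - (par_s - par_s^-1)^-1 *: (bwm_g i - bwm_gV i).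

(* BWM_(f-1) as the subalgebra of BWM_f generated by the g_i^{+-1} with
   1 <= i <= f - 2, i.e. with 0-based index at most f - 3 *)
Inductive in_BWM_pred : BWM -> Prop :=
| in_BWM_g (i : 'I_f.-1) : (i.+1 < f.-1)%N -> in_BWM_pred (bwm_g i)
| in_BWM_gV (i : 'I_f.-1) : (i.+1 < f.-1)%N -> in_BWM_pred (bwm_gV i)
| in_BWM_scal (c : Crs) : in_BWM_pred c%:A
| in_BWM_add x y : in_BWM_pred x -> in_BWM_pred y -> in_BWM_pred (x + y)
| in_BWM_mul x y : in_BWM_pred x -> in_BWM_pred y -> in_BWM_pred (x * y).

Record is_bwm_trace (tr : {scalar BWM}) : Prop := IsBwmTrace {
  bwm_tr1 : tr 1 = 1;
  bwm_trC : forall a b, tr (a * b) = tr (b * a);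
  bwm_tr_e : forall i, tr (bwm_e i) = par_x^-1;
  bwm_tr_g : forall i, tr (bwm_g i) = par_r / par_x;
  bwm_tr_gV : forall i, tr (bwm_gV i) = par_r^-1 / par_x;
  bwm_tr_markov_g : forall (i : 'I_f.-1) a b, i.+1 = f.-1 ->
    in_BWM_pred a -> in_BWM_pred b ->
    tr (a * bwm_g i * b) = tr (bwm_g i) * tr (a * b);
  bwm_tr_markov_e : forall (i : 'I_f.-1) a b, i.+1 = f.-1 ->
    in_BWM_pred a -> in_BWM_pred b ->
    tr (a * bwm_e i * b) = tr (bwm_e i) * tr (a * b)
}.

Definition hat_tr (tr : {scalar BWM}) (b : braid f) : Crs :=
  par_r ^ (- exp_sum b) * tr (braid_image bwm_g bwm_gV b).

Definition kauffman (hf : (1 < f)%N) (tr : {scalar BWM}) (b : braid f) : Crs :=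
  hat_tr tr (sigma1_pow hf 1) ^ (1 - f%:Z) * hat_tr tr b.

End BWM.
End Kauffman.

Section Weights.
Variable n : nat.

(* eps i is epsilon_{i+1} and alpha i is alpha_{i+1} *)
Definition eps (i : nat) : 'rV[int]_n := \row_j (j == i :> nat)%:R.

Definition dot (u v : 'rV[int]_n) : int := \sum_i u 0 i * v 0 i.

Definition alpha (i : 'I_n) : 'rV[int]_n :=
  if (i.+1 < n)%N then eps i - eps i.+1 else eps i.

(* the division is exact *)
Definition cartan (i j : 'I_n) : int :=
  ((2%:Z * dot (alpha i) (alpha j)) %/ dot (alpha i) (alpha i))%Z.

Definition two_rho_coord (i : 'I_n) : nat := 2 * (n - i) - 1.

Definition two_rho : 'rV[int]_n := \row_i (two_rho_coord i)%:Z.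

(* the coefficients of 2 rho on the simple roots, see two_rhoE *)
Definition two_rho_coef (i : 'I_n) : nat :=
  \sum_(j < n | (j <= i)%N) two_rho_coord j.

Lemma two_rhoE : two_rho = \sum_i alpha i *+ two_rho_coef i.
Proof.
apply/rowP => k; rewrite mxE summxE.
transitivity (\sum_(i < n) ((k == i :> nat)%:R *+ two_rho_coef i
                - (k == i.+1 :> nat)%:R *+ two_rho_coef i) : int); last first.
  apply: eq_bigr => i _; rewrite mulmxnE /alpha.
  case: ltnP => [_|ni]; rewrite !mxE ?mulrnBl //.
  by rewrite (ltn_eqF (leq_trans (ltn_ord k) ni)) mul0rn subr0.
rewrite sumrB (bigD1 k) //= eqxx big1 => [|i /negPf ik]; last first.
  by rewrite -(inj_eq val_inj) eq_sym in ik; rewrite ik mul0rn.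
rewrite addr0 -!/(two_rho_coord _) /two_rho_coef (bigD1 k) //=.
case: (posnP k) => [k0|k_gt0].
  rewrite [X in _ - X]big1 => [|i _]; last by rewrite k0 mul0rn.
  rewrite big1 ?addn0 ?subr0 ?natz// => i /andP[ik /negP[]].
  by apply/eqP/val_inj => /=; apply/eqP; rewrite eqn_leq ik k0.
have k1n : (k.-1 < n)%N by rewrite (leq_ltn_trans (leq_pred k)).
rewrite [X in _ - X](bigD1 (Ordinal k1n)) //= prednK // eqxx.
rewrite [X in _ - (_ + X)]big1 => [|i /negPf ik]; last first.
  case: eqP => [kE|]; last by rewrite mul0rn.
  by move: ik; rewrite -(inj_eq val_inj) /= kE /= eqxx.
rewrite addr0 mulrnDr [X in _ + X - _](_ : _ =
  1 *+ (\sum_(j < n | (j <= k.-1)%N) two_rho_coord j)%N) ?addrK ?natz //.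
congr Posz; apply: eq_bigl => j.
by rewrite -[in RHS]ltnS prednK // ltn_neqAle andbC.
Qed.

End Weights.

Section QuantumGroups.
Variables (F : fieldType) (n : nat).

Inductive generator : Type :=
| gE of 'I_n | gF of 'I_n | gK of 'I_n | gKV of 'I_n.

(* U_q(osp(1|2n)) and U_p(so(2n+1)) have the same presentation up to the
   parity of e_i and f_i, given by [odd_idx]. *)
Definition osp_odd (i : 'I_n) : bool := i.+1 == n.
Definition so_odd (i : 'I_n) : bool := false.

Section Parity.
Variable odd_idx : 'I_n -> bool.

Definition gparity (x : generator) : bool :=
  match x with gE i | gF i => odd_idx i | gK _ | gKV _ => false end.

(* Operators on the super vector space F^N, whose standard basis is
   homogeneous with parities [parity]. *)
Record gaction (N : nat) := GAction {
  parity : 'I_N -> bool;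
  act :> generator -> 'M[F]_N
}.

Definition parity_mx (N : nat) (par : 'I_N -> bool) : 'M[F]_N :=
  diag_mx (\row_a (-1) ^+ par a).

(* (w, b, X) stands for an element X of weight w and parity b *)
Definition hom_elt (N : nat) : Type := ('rV[int]_n * bool * 'M[F]_N)%type.

Definition qad (p : F) (N : nat) (x y : hom_elt N) : hom_elt N :=
  let: (wx, bx, X) := x in let: (wy, by_, Y) := y in
  (wx + wy, bx (+) by_,
   X *m Y - ((-1) ^+ (bx && by_) * p ^ dot wx wy) *: (Y *m X)).

Definition hom_E (N : nat) (V : gaction N) (i : 'I_n) : hom_elt N :=
  (alpha i, odd_idx i, V (gE i)).
Definition hom_F (N : nat) (V : gaction N) (i : 'I_n) : hom_elt N :=
  (- alpha i, odd_idx i, V (gF i)).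

Record is_module (p : F) (N : nat) (V : gaction N) : Prop := IsModule {
  mod_parity : forall x,
    parity_mx (parity V) *m V x
      = (-1) ^+ gparity x *: (V x *m parity_mx (parity V));
  mod_KK : forall i j, V (gK i) *m V (gK j) = V (gK j) *m V (gK i);
  mod_KKV : forall i, V (gK i) *m V (gKV i) = 1%:M;
  mod_KVK : forall i, V (gKV i) *m V (gK i) = 1%:M;
  mod_KE : forall i j, V (gK i) *m V (gE j) *m V (gKV i)
    = p ^ dot (alpha i) (alpha j) *: V (gE j);
  mod_KF : forall i j, V (gK i) *m V (gF j) *m V (gKV i)
    = p ^ (- dot (alpha i) (alpha j)) *: V (gF j);
  mod_EF : forall i j,
    V (gE i) *m V (gF j)
      - (-1) ^+ (odd_idx i && odd_idx j) *: (V (gF j) *m V (gE i))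
    = if i == j then (p - p^-1)^-1 *: (V (gK i) - V (gKV i)) else 0;
  mod_serreE : forall i j, i != j ->
    (iter `|1 - cartan i j|%N (qad p (hom_E V i)) (hom_E V j)).2 = 0;
  mod_serreF : forall i j, i != j ->
    (iter `|1 - cartan i j|%N (qad p (hom_F V i)) (hom_F V j)).2 = 0
}.

(* The action of a (x) b on V (x) W, for homogeneous b of parity [b_odd]:
   (a (x) b)(v (x) w) = (-1)^([b][v]) a v (x) b w. *)
Definition super_tens (N M : nat) (par : 'I_N -> bool)
    (A : 'M[F]_N) (b_odd : bool) (B : 'M[F]_M) : 'M[F]_(N * M) :=
  (if b_odd then A *m parity_mx par else A) *t B.

Definition tens_parity (N M : nat) (parV : 'I_N -> bool) (parW : 'I_M -> bool)
    (a : 'I_(N * M)) : bool :=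
  parV (mxtens_unindex a).1 (+) parW (mxtens_unindex a).2.

Definition coproduct (N M : nat) (V : gaction N) (W : gaction M) (x : generator)
    : 'M[F]_(N * M) :=
  let t := super_tens (parity V) in
  match x with
  | gE i => t (V (gE i)) false (W (gK i)) + t 1%:M (odd_idx i) (W (gE i))
  | gF i => t (V (gF i)) false 1%:M + t (V (gKV i)) (odd_idx i) (W (gF i))
  | gK i => t (V (gK i)) false (W (gK i))
  | gKV i => t (V (gKV i)) false (W (gKV i))
  end.

(* P o Delta, with P(a (x) b) = (-1)^([a][b]) b (x) a *)
Definition coproduct_op (N M : nat) (V : gaction N) (W : gaction M)
    (x : generator) : 'M[F]_(N * M) :=
  let t := super_tens (parity V) in
  match x with
  | gE i => t (V (gK i)) (odd_idx i) (W (gE i)) + t (V (gE i)) false 1%:M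
  | gF i => t 1%:M (odd_idx i) (W (gF i)) + t (V (gF i)) false (W (gKV i))
  | gK i => t (V (gK i)) false (W (gK i))
  | gKV i => t (V (gKV i)) false (W (gKV i))
  end.

Definition tens_action (N M : nat) (V : gaction N) (W : gaction M)
    : gaction (N * M) :=
  GAction (tens_parity (parity V) (parity W)) (coproduct V W).

(* P(v (x) w) = (-1)^([v][w]) w (x) v *)
Definition super_perm (N : nat) (par : 'I_N -> bool) : 'M[F]_(N * N) :=
  \matrix_(a, b)
    let: (a1, a2) := mxtens_unindex a in
    let: (b1, b2) := mxtens_unindex b in
    if (a1 == b2) && (a2 == b1) then (-1) ^+ (par b1 && par b2) else 0.

Section Submodules.
Variables (N : nat) (V : gaction N).

Definition submodule (U : {vspace 'cV[F]_N}) : Prop :=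
  (forall x v, v \in U -> V x *m v \in U) /\
  (forall v, v \in U -> parity_mx (parity V) *m v \in U).

Definition irreducible (U : {vspace 'cV[F]_N}) : Prop :=
  [/\ submodule U, U != 0%VS
    & forall W, submodule W -> (W <= U)%VS -> W = 0%VS \/ W = U].

Definition highest_weight_vector (p : F) (lambda : 'rV[int]_n) (v : 'cV[F]_N)
    : Prop :=
  [/\ v != 0, forall i, V (gE i) *m v = 0
    & forall i, V (gK i) *m v = p ^ dot (alpha i) lambda *: v].

Definition irreducible_hw (p : F) (lambda : 'rV[int]_n)
    (U : {vspace 'cV[F]_N}) : Prop :=
  irreducible U /\ exists2 v, v \in U & highest_weight_vector p lambda v.

End Submodules.

Definition mu_weight : 'rV[int]_n :=
  if (2 <= n)%N then eps n 0 + eps n 1 else eps n 0.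

Definition Rcheck (N : nat) (V : gaction N) (Rm : 'M[F]_(N * N)) :=
  super_perm (parity V) *m Rm.

(* U_q(osp(1|2n)) has p = q and U_(-q)(so(2n+1)) has p = - q; the scalars are
   expressed through q in both cases. *)
Record is_R_matrix (p q : F) (N : nat) (V : gaction N) (Rm : 'M[F]_(N * N))
    : Prop := IsRMatrix {
  R_intertwines : forall x,
    Rm *m coproduct V V x = coproduct_op V V x *m Rm;
  R_spectrum : exists U2 Umu U0 : {vspace 'cV[F]_(N * N)},
    [/\ [/\ irreducible_hw (tens_action V V) p (eps n 0 *+ 2) U2,
            irreducible_hw (tens_action V V) p mu_weight Umu
          & irreducible_hw (tens_action V V) p 0 U0],
        (U2 + Umu + U0)%VS = fullv, directv (U2 + Umu + U0)
      & [/\ forall v, v \in U2 -> Rcheck V Rm *m v = (- q) *: v,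
            forall v, v \in Umu -> Rcheck V Rm *m v = q^-1 *: v
          & forall v, v \in U0 -> Rcheck V Rm *m v = q ^- (2 * n) *: v]]
}.

End Parity.

(* The highest weight vector is odd for osp; the so module is ungraded. *)
Definition osp_vector_module (q : F) (V : gaction n.*2.+1) : Prop :=
  [/\ is_module osp_odd q V, irreducible V fullv
    & exists2 v, highest_weight_vector V q (eps n 0) v
        & parity_mx (parity V) *m v = - v].

Definition so_vector_module (p : F) (V : gaction n.*2.+1) : Prop :=
  [/\ is_module so_odd p V, forall a, parity V a = false,
      irreducible V fullv
    & exists v, highest_weight_vector V p (eps n 0) v].

Lemma dim_split (N f : nat) (i : 'I_f.-1) :
  (N ^ i * (N * N) * N ^ (f - i.+2) = N ^ f)%N.
Proof.
case: f i => [|[|f]] [i //= hi].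
by rewrite mulnn -!expnD addn2 subnKC.
Qed.

Definition local_mx (N f : nat) (X : 'M[F]_(N * N)) (i : 'I_f.-1)
    : 'M[F]_(N ^ f) :=
  castmx (dim_split N i, dim_split N i)
    ((1%:M : 'M_(N ^ i)) *t X *t (1%:M : 'M_(N ^ (f - i.+2)))).

Definition braid_mx (N f : nat) (X : 'M[F]_(N * N)) (b : braid f)
    : 'M[F]_(N ^ f) :=
  braid_image (local_mx X) (local_mx (invmx X)) b.

Definition k_two_rho (N : nat) (V : gaction N) : 'M[F]_N :=
  \prod_(i < n) V (gK i) ^+ two_rho_coef i.

(* k_(2 rho) is group-like, so it acts on V^(x) f by its f-th tensor power;
   str is the trace twisted by the parity operator of V^(x) f. *)
Definition str_q (N f : nat) (V : gaction N) (X : 'M[F]_(N ^ f)) : F :=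
  \tr ((parity_mx (parity V) ^t f) *m (k_two_rho V ^t f) *m X).

Definition tr_q (N f : nat) (V : gaction N) (X : 'M[F]_(N ^ f)) : F :=
  \tr ((k_two_rho V ^t f) *m X).

Definition qdim (q : F) : F :=
  (- q ^+ (2 * n) + q ^- (2 * n)) / (q - q^-1) + 1.

(* The link polynomial of a Markov trace psi, where u and v are the chosen
   square roots u = (z z~)^(-1/2) and v = (z~ / z)^(1/2). *)
Definition link_polynomial (f : nat) (A : Type) (u v : F)
    (rho : braid f -> A) (psi : A -> F) (b : braid f) : F :=
  u ^+ f.-1 * v ^ exp_sum b * psi (rho b).

(* Here z = q^(2n) / D and z~ = q^(-2n) / D with D = qdim q. *)
Definition Phi_osp (q : F) (f : nat) (V : gaction n.*2.+1)
    (Rm : 'M[F]_(n.*2.+1 * n.*2.+1)) (b : braid f) : F :=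
  link_polynomial (qdim q) (q ^- (2 * n)) (braid_mx (Rcheck V Rm))
    (fun X => str_q V X / qdim q ^+ f) b.

Definition Phi_so (q : F) (f : nat) (V : gaction n.*2.+1)
    (Rm : 'M[F]_(n.*2.+1 * n.*2.+1)) (b : braid f) : F :=
  link_polynomial (qdim q) (q ^- (2 * n)) (braid_mx (Rcheck V Rm))
    (fun X => tr_q V X / qdim q ^+ f) b.

End QuantumGroups.

(* Main.v *)
Require Import Defs.
From HB Require Import structures.
From mathcomp Require Import all_boot all_order all_algebra.
From mathcomp Require Import boolp reals.
From mathcomp.real_closed Require Import complex mxtens.
From mathcomp Require Import mpoly.
From mathcomp Require Import generic_quotient fraction ring zify.

Set Implicit Arguments.
Unset Strict Implicit.
Unset Printing Implicit Defensive.

Import Order.TTheory GRing.Theory Num.Theory.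
Local Open Scope ring_scope.

(* Kauffman invariant: from g - g^-1 = (s - s^-1)(1 - e) and e g = r^-1 e, the
   traces t_k = tr(g^k) satisfy
     t_(k+2) = t_k + (s - s^-1)(t_(k+1) - r^-(k+1) / x),
   so (r, s) -> (- r, - s) multiplies t_k by (-1)^k, as it does r^k.

   Quantum invariants: both link polynomials are determined by the twisted
   traces of the projections of V (x) V onto its three irreducible components
   and by the twisted trace of V, so it suffices that an irreducible
   U_q(osp(1|2n))-module and an irreducible U_(-q)(so(2n+1))-module with the
   same highest weight have the same twisted trace.  Up to signs depending only
   on the weight, e_i and f_i satisfy the same relations in both algebras, and
   the usual uniqueness argument for irreducible highest weight modules (the
   submodule generated by a pair of highest weight vectors is the graph of an
   isomorphism) applies across the two algebras.  The isomorphism preserves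
   weights, and str k_(2 rho) and tr K_(2 rho) agree weight by weight because
   (-1)^(mu_1 + ... + mu_n) q^(2 rho, mu) = (-q)^(2 rho, mu). *)

(** * The Kauffman invariant *)

Lemma frac_numden (A : idomainType) (x : {fraction A}) :
  x = tofrac \n_(repr x) / tofrac \d_(repr x).
Proof.
have d0 : tofrac \d_(repr x) != 0 by rewrite tofrac_eq0 denom_ratioP.
apply: (canRL (mulfK d0)).
have h (z : {ratio A}) : (\pi_({fraction A}) z)%qT * tofrac \d_z = tofrac \n_z.
  rewrite /= !piE; apply/eqmodP; rewrite /= FracField.equivfE /FracField.mulf.
  by rewrite !numden_Ratio ?mulf_neq0 ?oner_neq0 ?denom_ratioP // !mulr1 mulrC.
by rewrite -h reprK.
Qed.

(** * Extension of an injective ring morphism to fraction fields *)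

Section FracMap.
Variables (A : idomainType) (h : {rmorphism A -> A}).
Hypothesis h_inj : injective h.
Implicit Types (a b : A) (x y : {fraction A}).

(** For [h := mpoly_neg_vars] this is convertible to [neg_params], so the morphism laws proved here
    transfer to it directly. *)
Definition frac_map x : {fraction A} :=
  tofrac (h \n_(repr x)) / tofrac (h \d_(repr x)).

Let h_neq0 b : b != 0 -> tofrac (h b) != 0.
Proof. by rewrite tofrac_eq0 raddf_eq0. Qed.

(** Independence of the representative: equality of fractions is a cross-multiplied identity in [A],
    which [h] preserves, and injectivity keeps the denominators non-zero. *)
Lemma frac_map_div a b : b != 0 ->
  frac_map (tofrac a / tofrac b) = tofrac (h a) / tofrac (h b).
Proof.
move=> b0; rewrite /frac_map; set x := tofrac a / tofrac b.
have d0 : \d_(repr x) != 0 by exact: denom_ratioP.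
apply/eqP; rewrite eqr_div ?h_neq0 // -!tofracM tofrac_eq -!rmorphM.
have /eqP := frac_numden x; rewrite {1}/x eqr_div ?tofrac_eq0 //.
by rewrite -!tofracM tofrac_eq => /eqP ->.
Qed.

Lemma frac_map_tofrac a : frac_map (tofrac a) = tofrac (h a).
Proof.
by have := frac_map_div a (oner_neq0 _); rewrite !rmorph1 !divr1.
Qed.

Lemma frac_map_zmod_morphism : zmod_morphism frac_map.
Proof.
move=> x y; rewrite (frac_numden x) (frac_numden y).
have dx : \d_(repr x) != 0 by exact: denom_ratioP.
have dy : \d_(repr y) != 0 by exact: denom_ratioP.
rewrite -mulNr addf_div ?tofrac_eq0 // -tofracN -!tofracM -tofracD.
rewrite !frac_map_div ?mulf_neq0 // -[in RHS]mulNr addf_div ?h_neq0 //.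
by rewrite -tofracN -!tofracM -tofracD rmorphD !rmorphM rmorphN.
Qed.

Lemma frac_map_monoid_morphism : monoid_morphism frac_map.
Proof.
split=> [|x y]; first by rewrite -(tofrac1 A) frac_map_tofrac rmorph1.
rewrite (frac_numden x) (frac_numden y).
have dx : \d_(repr x) != 0 by exact: denom_ratioP.
have dy : \d_(repr y) != 0 by exact: denom_ratioP.
rewrite mulf_div -!tofracM !frac_map_div ?mulf_neq0 // mulf_div.
by rewrite -!tofracM !rmorphM.
Qed.

End FracMap.

(** Being an involution makes the sign change injective, so that it extends to fractions. *)
Lemma mpoly_neg_varsK (R : realType) : involutive (@mpoly_neg_vars R).
Proof.
move=> p; rewrite /mpoly_neg_vars; set t := [tuple _ | _ < _].
have h m : ('X_[m] \mPo t) \mPo t = 'X_[m] :> {mpoly R[i][2]}.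
  rewrite !comp_mpolyX rmorph_prod /= [RHS]mpolyXE_id.
  apply: eq_bigr => i _; rewrite rmorphXn /= tnth_mktuple comp_mpolyN.
  by rewrite comp_mpolyXU -tnth_nth tnth_mktuple opprK.
rewrite [in RHS](mpolyE p) {1}(mpolyE p).
have S (s : seq 'X_{1..2}) (G : 'X_{1..2} -> {mpoly R[i][2]}) :
    (\sum_(m <- s) G m) \mPo t = \sum_(m <- s) (G m \mPo t).
  exact: raddf_sum.
rewrite !(S (msupp p)).
by apply: eq_bigr => m _; rewrite !comp_mpolyZ h.
Qed.

Lemma mpoly_neg_vars_zmod_morphism (R : realType) :
  zmod_morphism (@mpoly_neg_vars R).
Proof. by move=> p q; rewrite /mpoly_neg_vars comp_mpolyB. Qed.

Lemma mpoly_neg_vars_monoid_morphism (R : realType) :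
  monoid_morphism (@mpoly_neg_vars R).
Proof.
split=> [|p q]; first exact: comp_mpoly1.
exact: (rmorphM (comp_mpoly [tuple - 'X_j | j < 2])).
Qed.

HB.instance Definition _ (R : realType) :=
  GRing.isZmodMorphism.Build {mpoly R[i][2]} {mpoly R[i][2]}
    (@mpoly_neg_vars R) (@mpoly_neg_vars_zmod_morphism R).
HB.instance Definition _ (R : realType) :=
  GRing.isMonoidMorphism.Build {mpoly R[i][2]} {mpoly R[i][2]}
    (@mpoly_neg_vars R) (@mpoly_neg_vars_monoid_morphism R).

HB.instance Definition _ (R : realType) :=
  GRing.isZmodMorphism.Build (Crs R) (Crs R) (@neg_params R)
    (frac_map_zmod_morphism (can_inj (@mpoly_neg_varsK R))).
HB.instance Definition _ (R : realType) :=
  GRing.isMonoidMorphism.Build (Crs R) (Crs R) (@neg_params R)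
    (frac_map_monoid_morphism (can_inj (@mpoly_neg_varsK R))).

Lemma neg_params_X (R : realType) (j : 'I_2) :
  neg_params (tofrac ('X_j : {mpoly R[i][2]})) = - tofrac 'X_j.
Proof.
rewrite [LHS](frac_map_tofrac (can_inj (@mpoly_neg_varsK R))) /= /mpoly_neg_vars.
by rewrite comp_mpolyXU -tnth_nth tnth_mktuple tofracN.
Qed.

Lemma neg_params_r (R : realType) : neg_params (par_r R) = - par_r R.
Proof. exact: neg_params_X. Qed.

Lemma neg_params_s (R : realType) : neg_params (par_s R) = - par_s R.
Proof. exact: neg_params_X. Qed.

Lemma neg_params_x (R : realType) : neg_params (par_x R) = par_x R.
Proof.
rewrite /par_x rmorphD rmorph1 fmorph_div !rmorphB !fmorphV /=.
by rewrite neg_params_r neg_params_s !invrN -!opprD invrN mulrNN.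
Qed.

(** * Traces of the powers of a generator in the BWM algebra *)

Section BwmPowers.
Variables (R : realType) (f : nat).
Local Notation BWM := (BWM R f).
Local Notation r := (par_r R).
Local Notation s := (par_s R).
Local Notation x := (par_x R).
Local Notation g := (@bwm_g R f).
Local Notation gV := (@bwm_gV R f).
Local Notation e := (@bwm_e R f).
Implicit Types (i : 'I_f.-1) (k : nat).

Lemma par_r_neq0 : r != 0.
Proof.
rewrite tofrac_eq0; apply/eqP => /(congr1 (mcoeff U_(ord0))).
by rewrite mcoeffX eqxx mcoeff0 => /eqP; rewrite oner_eq0.
Qed.

Local Notation piB := \pi_(presented (@bwm_rel R f))%qT.

Lemma bwm_pi_rel t u : @bwm_rel R f t u -> piB t = piB u :> BWM.
Proof. by move=> tu; apply/presentedP/cong_rel. Qed.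

Lemma bwm_gK i : g i * gV i = 1.
Proof. rewrite [LHS]pmulE; exact: (bwm_pi_rel (bwm_inv R i false)). Qed.

Lemma bwm_gVK i : gV i * g i = 1.
Proof. rewrite [LHS]pmulE; exact: (bwm_pi_rel (bwm_inv R i true)). Qed.

Lemma bwm_eE i : e i = piB (tE R i).
Proof.
rewrite /bwm_e -scaleNr.
have -> : - gV i = piB (Opp (tG R (i, true))) by exact: poppE.
rewrite [g i + _]paddE.
have -> c (t : term (Crs R) ('I_f.-1 * bool)) :
  c *: (piB t : BWM) = piB (Mul (Scal c) t) by exact: pmulE.
exact: paddE.
Qed.

Lemma bwm_eg i : e i * g i = r^-1 *: e i.
Proof.
rewrite !bwm_eE [LHS]pmulE [RHS]pmulE; exact: bwm_pi_rel (bwm_eg _ _).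
Qed.

Lemma bwm_egV i : e i * gV i = r *: e i.
Proof.
rewrite -[in RHS](mulr1 (e i)) -(bwm_gK i) mulrA bwm_eg -scalerAl scalerA.
by rewrite mulfV ?par_r_neq0 ?scale1r.
Qed.

Lemma bwm_gB i : g i - gV i = (s - s^-1) *: (1 - e i).
Proof.
rewrite /bwm_e subKr scalerA mulfV ?scale1r //.
exact: par_s_subV_neq0.
Qed.

Section Trace.
Variable tr : {scalar BWM}.
Hypothesis trP : is_bwm_trace tr.

Lemma bwm_trM_e_g k i : tr (e i * g i ^+ k) = r^-1 ^+ k / x.
Proof.
elim: k => [|k IH]; first by rewrite !expr0 mulr1 mul1r (bwm_tr_e trP).
by rewrite exprS mulrA bwm_eg -scalerAl linearZ /= IH exprS mulrA.
Qed.

Lemma bwm_trM_e_gV k i : tr (e i * gV i ^+ k) = r ^+ k / x.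
Proof.
elim: k => [|k IH]; first by rewrite !expr0 mulr1 mul1r (bwm_tr_e trP).
by rewrite exprS mulrA bwm_egV -scalerAl linearZ /= IH exprS mulrA.
Qed.

(** This is [bwm_gB] multiplied by [g i ^+ k.+1]; since [e i] absorbs powers of [g i] up to scalars,
    the trace of the extra term is explicit. *)
Lemma bwm_tr_g_rec k i : tr (g i ^+ k.+2)
  = tr (g i ^+ k) + (s - s^-1) * (tr (g i ^+ k.+1) - r^-1 ^+ k.+1 / x).
Proof.
have -> : g i ^+ k.+2
    = g i ^+ k + (s - s^-1) *: (g i ^+ k.+1 - e i * g i ^+ k.+1).
  rewrite -{1}[g i ^+ k.+1]mul1r -mulrBl scalerAl -bwm_gB mulrBl -exprS.
  by rewrite [in gV i * _]exprS mulrA bwm_gVK mul1r addrC subrK.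
by rewrite linearD linearZ linearB /= bwm_trM_e_g.
Qed.

(** Mirror image for negative exponents: [bwm_gB] multiplied by [gV i ^+ k.+1], whence the opposite
    sign. *)
Lemma bwm_tr_gV_rec k i : tr (gV i ^+ k.+2)
  = tr (gV i ^+ k) - (s - s^-1) * (tr (gV i ^+ k.+1) - r ^+ k.+1 / x).
Proof.
have -> : gV i ^+ k.+2
    = gV i ^+ k - (s - s^-1) *: (gV i ^+ k.+1 - e i * gV i ^+ k.+1).
  rewrite -{1}[gV i ^+ k.+1]mul1r -mulrBl scalerAl -bwm_gB mulrBl -(exprS (gV i)).
  by rewrite [in g i * _]exprS mulrA bwm_gK mul1r opprB addrC subrK.
by rewrite linearB linearZ linearB /= bwm_trM_e_gV.
Qed.

Let negV : neg_params r^-1 = - r^-1.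
Proof. by rewrite fmorphV /= neg_params_r invrN. Qed.
Let negz : neg_params (s - s^-1) = - (s - s^-1).
Proof. by rewrite rmorphB fmorphV /= neg_params_s invrN -opprD. Qed.
Let neg_rX k : neg_params (r ^+ k / x) = (-1) ^+ k * (r ^+ k / x).
Proof.
by rewrite fmorph_div rmorphXn /= neg_params_r neg_params_x (exprNn r) mulrA.
Qed.
Let neg_rVX k : neg_params (r^-1 ^+ k / x) = (-1) ^+ k * (r^-1 ^+ k / x).
Proof.
by rewrite fmorph_div rmorphXn /= negV neg_params_x (exprNn r^-1) mulrA.
Qed.

Lemma neg_params_tr_g k i : neg_params (tr (g i ^+ k)) = (-1) ^+ k * tr (g i ^+ k).
Proof.
pose P j := neg_params (tr (g i ^+ j)) = (-1) ^+ j * tr (g i ^+ j).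
(* The recursion has order two, so the induction carries two consecutive exponents. *)
suff [] : P k /\ P k.+1 by []; rewrite /P {P}.
elim: k => [|k [IH0 IH1]]; split=> //.
- by rewrite !expr0 (bwm_tr1 trP) rmorph1 mulr1.
- by rewrite !expr1 (bwm_tr_g trP) (neg_rX 1).
rewrite bwm_tr_g_rec rmorphD rmorphM (rmorphB _ (tr _)) /= IH0 IH1 negz neg_rVX.
rewrite !exprS; ring.
Qed.

Lemma neg_params_tr_gV k i :
  neg_params (tr (gV i ^+ k)) = (-1) ^+ k * tr (gV i ^+ k).
Proof.
pose P j := neg_params (tr (gV i ^+ j)) = (-1) ^+ j * tr (gV i ^+ j).
suff [] : P k /\ P k.+1 by []; rewrite /P {P}.
elim: k => [|k [IH0 IH1]]; split=> //.
- by rewrite !expr0 (bwm_tr1 trP) rmorph1 mulr1.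
- by rewrite !expr1 (bwm_tr_gV trP) (neg_rVX 1).
rewrite bwm_tr_gV_rec rmorphB rmorphM (rmorphB _ (tr _)) /= IH0 IH1 negz neg_rX.
rewrite !exprS; ring.
Qed.

End Trace.
End BwmPowers.

Lemma braid_image_sigma1_pow (f : nat) (hf : (1 < f)%N) (A : pzRingType)
    (g gV : 'I_f.-1 -> A) (m : int) :
  braid_image g gV (sigma1_pow hf m)
    = (if m < 0 then gV (sigma1 hf) else g (sigma1 hf)) ^+ `|m|%N.
Proof.
rewrite /braid_image /sigma1_pow; elim: `|m|%N => [|k IH] /=.
  by rewrite big_nil.
by rewrite big_cons IH exprS.
Qed.

Lemma exp_sum_sigma1_pow (f : nat) (hf : (1 < f)%N) (m : int) :
  exp_sum (sigma1_pow hf m) = m.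
Proof.
rewrite /exp_sum /sigma1_pow big_nseq /=.
have it (c : int) k : iter k (+%R c) 0 = c *+ k.
  by elim: k => // k IH; rewrite iterS IH mulrS.
rewrite it; case: (intP m) => [|k|k] //=; first by rewrite natz.
by rewrite expr1 mulNrn natz.
Qed.

Lemma kauffman_sigma1_neg (R : realType) (f : nat) (hf : (1 < f)%N) (m : int)
    (tr : {scalar BWM R f}) : is_bwm_trace tr ->
  neg_params (kauffman hf tr (sigma1_pow hf m))
    = kauffman hf tr (sigma1_pow hf m).
Proof.
move=> trP.
have hat k : neg_params (hat_tr tr (sigma1_pow hf k)) = hat_tr tr (sigma1_pow hf k).
  rewrite /hat_tr braid_image_sigma1_pow exp_sum_sigma1_pow rmorphM fmorphXz.
  rewrite /= neg_params_r.
  (* The power of [par_r] and the trace both change by (-1) to the power |k|, and the two signs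
     cancel. *)
  have -> : (- par_r R) ^ (- k) = (-1) ^+ `|k|%N * par_r R ^ (- k).
    case: (intP k) => [|n|n].
    - by rewrite oppr0 !expr0z mul1r.
    - by rewrite -!exprnN (exprNn (par_r R)) invfM invr_sign.
    - by rewrite opprK abszN /= -!exprnP (exprNn (par_r R)).
  case: ifP => _; rewrite ?neg_params_tr_g ?neg_params_tr_gV //;
    by rewrite mulrACA -exprMn mulrNN mulr1 expr1n mul1r.
(* [hat] is used twice: at [m], and at 1 for the normalising factor. *)
by rewrite /kauffman rmorphM fmorphXz /= !hat.
Qed.

(** * Weights *)

Section Weights.
Variable n : nat.
Implicit Types (u v w mu : 'rV[int]_n) (i j : 'I_n).

Lemma dotC u v : dot u v = dot v u.
Proof. by apply: eq_bigr => i _; rewrite mulrC. Qed.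

Lemma dotDr u v w : dot u (v + w) = dot u v + dot u w.
Proof. by rewrite -big_split; apply: eq_bigr => i _; rewrite mxE mulrDr. Qed.

Lemma dotNr u v : dot u (- v) = - dot u v.
Proof. by rewrite -sumrN; apply: eq_bigr => i _; rewrite mxE mulrN. Qed.

Lemma dotBr u v w : dot u (v - w) = dot u v - dot u w.
Proof. by rewrite dotDr dotNr. Qed.

Lemma dotBl u v w : dot (u - v) w = dot u w - dot v w.
Proof. by rewrite dotC dotBr !(dotC w). Qed.

Lemma dot_epsl (k : nat) (kn : (k < n)%N) u : dot (eps n k) u = u 0 (Ordinal kn).
Proof.
rewrite /dot (bigD1 (Ordinal kn)) //= mxE eqxx mul1r big1 ?addr0 // => i.
by rewrite -(inj_eq val_inj) /= mxE => /negPf ->; rewrite mul0r.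
Qed.

Lemma eps_ge k : (n <= k)%N -> eps n k = 0.
Proof.
move=> nk; apply/rowP => j; rewrite !mxE.
by rewrite (ltn_eqF (leq_trans (ltn_ord j) nk)).
Qed.

Lemma dot0l u : dot 0 u = 0.
Proof. by rewrite -[0 : 'rV_n](subrr 0) dotBl subrr. Qed.

Lemma dot_eps a b : dot (eps n a) (eps n b) = ((a == b) && (a < n)%N)%:R.
Proof.
case: (ltnP a n) => an; last by rewrite eps_ge // andbF dot0l.
by rewrite (dot_epsl an) mxE andbT.
Qed.

(** Because [eps n n] is 0, the short last root obeys the formula of the long ones and needs no
    separate case. *)
Lemma alphaE i : alpha i = eps n i - eps n i.+1.
Proof.
by rewrite /alpha; case: ltnP => // ni; rewrite (eps_ge ni) subr0.
Qed.

(** The simple roots span, so the exponents of the [k_i] determine the weight. Pairings with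
    [eps n k] are recovered by descending induction on [k], starting where [eps n k] is 0. *)
Lemma dot_alpha_inj u v : (forall i, dot (alpha i) u = dot (alpha i) v) -> u = v.
Proof.
move=> h; suff E k : dot (eps n k) u = dot (eps n k) v.
  by apply/rowP => j; have := E j; rewrite !(dot_epsl (ltn_ord j)); congr (_ = _);
    congr (_ 0 _); apply: val_inj.
elim: {k}(n - k)%N {-2}k (erefl (n - k)%N) => [|d IH] k.
  by move/eqP; rewrite subn_eq0 => nk; rewrite eps_ge // !dot0l.
move=> dE; have kn : (k < n)%N by rewrite -subn_gt0 dE.
have := h (Ordinal kn); rewrite alphaE !dotBl /= (IH k.+1); last first.
  by rewrite subnS dE.
by move/addIr.
Qed.

(** Modulo 2 this is the parity that a weight carries for osp: it is 1 on the last simple root, the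
    odd one, and 0 on the others. *)
Definition wsum u : int := \sum_i u 0 i.

Lemma wsumD u v : wsum (u + v) = wsum u + wsum v.
Proof. by rewrite -big_split; apply: eq_bigr => i _; rewrite mxE. Qed.

Lemma wsumN u : wsum (- u) = - wsum u.
Proof. by rewrite -sumrN; apply: eq_bigr => i _; rewrite mxE. Qed.

Lemma wsum_eps k : wsum (eps n k) = (k < n)%N%:R.
Proof.
case: ltnP => kn; last by rewrite eps_ge // /wsum big1 // => i _; rewrite mxE.
rewrite /wsum (bigD1 (Ordinal kn)) //= mxE eqxx big1 ?addr0 // => i.
by rewrite -(inj_eq val_inj) /= mxE => /negPf ->.
Qed.

Lemma wsum_alpha i : wsum (alpha i) = (i.+1 == n)%:R.
Proof.
rewrite alphaE wsumD wsumN !wsum_eps ltn_ord.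
by case: (ltngtP i.+1 n) (ltn_ord i) => //;
  rewrite ltnS => h /(leq_trans h); rewrite ltnn.
Qed.

Lemma dot_two_rho_eps k : dot (two_rho n) (eps n k)
  = if (k < n)%N then (2 * (n - k) - 1)%N%:Z else 0.
Proof.
rewrite dotC; case: ltnP => kn; last by rewrite eps_ge ?dot0l.
by rewrite (dot_epsl kn) mxE.
Qed.

(** Makes the pairing with [two_rho n] a height function that each [f_i] strictly lowers. *)
Lemma dot_two_rho_alpha i : 0 < dot (two_rho n) (alpha i).
Proof.
rewrite alphaE dotBr !dot_two_rho_eps ltn_ord.
rewrite subr_gt0; case: ltnP => h; rewrite ltz_nat; have := ltn_ord i; lia.
Qed.

End Weights.

(** * Subspaces given by predicates, and sums of weight pieces *)

Section LinClosed.
Variable F : fieldType.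

Record lin_closed (L : lmodType F) (P : L -> Prop) : Prop := LinClosed {
  lin0 : P 0;
  linD : forall x y, P x -> P y -> P (x + y);
  linZ : forall c x, P x -> P (c *: x)
}.

Lemma linB (L : lmodType F) (P : L -> Prop) x y :
  lin_closed P -> P x -> P y -> P (x - y).
Proof.
by move=> hP Px Py; apply: linD => //; rewrite -scaleN1r; apply: linZ.
Qed.

Lemma lin_sum (L : lmodType F) (P : L -> Prop) (I : Type) (s : seq I)
    (X : I -> L) :
  lin_closed P -> (forall i, P (X i)) -> P (\sum_(i <- s) X i).
Proof. by move=> [P0 PD _] h; elim/big_ind: _ => // i _; apply: h. Qed.

(** Keep adjoining to [U] a vector of [P] outside [U]: the codimension drops each time, so the
    process stops at a [U] containing all of [P]. *)
Lemma lin_closed_vspace (L : vectType F) (P : L -> Prop) :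
  lin_closed P -> exists U : {vspace L}, forall x, x \in U <-> P x.
Proof.
move=> hP; pose inP (U : {vspace L}) := forall x, x \in U -> P x.
suff [U [UP maxU]] : exists U, inP U /\ forall x, P x -> x \in U.
  by exists U => x; split; [apply: UP | apply: maxU].
suff H d (U : {vspace L}) : inP U -> (\dim {:L} - \dim U < d)%N ->
    exists U, inP U /\ forall x, P x -> x \in U.
  apply: (H _ 0%VS _ (ltnSn _)) => x; rewrite memv0 => /eqP ->; exact: lin0 hP.
elim: d U => // d IH U UP lt_d.
have [[x [Px xU]]|noP] := pselect (exists x, P x /\ x \notin U); last first.
  by exists U; split=> // x Px; apply: contrapT => /negP xU; case: noP; exists x.
apply: (IH (U + <[x]>)%VS) => [_ /memv_addP [u uU [_ /vlineP [c ->] ->]]|].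
  by apply: (linD hP); [apply: UP | apply: (linZ hP)].
have ltU : (\dim U < \dim (U + <[x]>))%N.
  rewrite ltn_neqAle dimvS ?addvSl // andbT; apply: contra xU => /eqP dU.
  have /eqP -> : U == (U + <[x]>)%VS by rewrite eqEdim addvSl dU leqnn.
  by rewrite (subvP (addvSr U _)) // memv_line.
have := dimvS (subvf (U + <[x]>)%VS); lia.
Qed.

Variable n : nat.
Local Notation wt := 'rV[int]_n.

(** The sum of the subspaces [P mu] over all weights, without fixing a finite set of weights in
    advance. *)
Inductive gspan (L : lmodType F) (P : wt -> L -> Prop) : L -> Prop :=
| gspan0 : gspan P 0
| gspan_cons mu x y : P mu x -> gspan P y -> gspan P (x + y).

Definition graded (L : lmodType F) (P : wt -> L -> Prop) :=
  forall mu, lin_closed (P mu).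

Lemma gspan_in (L : lmodType F) (P : wt -> L -> Prop) mu x :
  P mu x -> gspan P x.
Proof. by move=> h; rewrite -[x]addr0; apply: gspan_cons h (gspan0 P). Qed.

Lemma gspan_map (L L' : lmodType F) (P : wt -> L -> Prop)
    (P' : wt -> L' -> Prop) (g : wt -> wt) (h : L -> L') :
  h 0 = 0 -> {morph h : x y / x + y} ->
  (forall mu x, P mu x -> P' (g mu) (h x)) ->
  forall x, gspan P x -> gspan P' (h x).
Proof.
move=> h0 hD hP x; elim=> [|mu {}x y Px _ IH]; first by rewrite h0; constructor.
by rewrite hD; apply: gspan_cons (hP _ _ Px) IH.
Qed.

Lemma gspan_lin (L : lmodType F) (P : wt -> L -> Prop) :
  graded P -> lin_closed (gspan P).
Proof.
move=> gP; split=> [|x y Px Py|c x]; first exact: gspan0.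
  elim: Px => [|mu {}x z Px _ IH]; first by rewrite add0r.
  by rewrite -addrA; apply: gspan_cons Px IH.
apply: (@gspan_map L L P P id) => [|y z|mu y Py]; rewrite ?scaler0 ?scalerDr //.
exact: linZ.
Qed.

Lemma gspan_sub (L : lmodType F) (P : wt -> L -> Prop) (Q : L -> Prop) x :
  lin_closed Q -> (forall mu x, P mu x -> Q x) -> gspan P x -> Q x.
Proof.
move=> hQ hP; elim=> [|mu {}x y Px _ IH]; first exact: lin0.
by apply: linD => //; apply: hP Px.
Qed.

(** Gathers the summands of equal weight, so that each weight occurs once and independence of weight
    spaces can be applied. *)
Lemma gspan_fin (L : lmodType F) (P : wt -> L -> Prop) x :
  graded P -> gspan P x -> exists s : seq wt, exists X : wt -> L,
    [/\ uniq s, forall mu, P mu (X mu) & x = \sum_(mu <- s) X mu].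
Proof.
move=> gP; elim=> [|mu {}x y Px _ [s [X [us PX ->]]]].
  by exists [::], (fun=> 0); split=> // [mu|]; [apply: lin0 | rewrite big_nil].
pose s' := mu :: rem mu s.
(* [X'] adds the new vector to the summand of weight [mu] already present, or to 0 if there is
   none. *)
pose X' nu := if nu == mu then x + (if mu \in s then X mu else 0) else X nu.
exists s', X'; split.
- by rewrite /s' /= rem_uniq // mem_rem_uniq // !inE eqxx.
- move=> nu; rewrite /X'; case: eqP => [->|_] //.
  by apply: (linD (gP _)) => //; case: ifP => _ //; apply: (lin0 (gP _)).
rewrite big_cons {1}/X' eqxx -addrA; congr (_ + _).
have eqX : \sum_(nu <- rem mu s) X' nu = \sum_(nu <- rem mu s) X nu.
  apply: eq_big_seq => nu; rewrite mem_rem_uniq // !inE /X' => /andP[/negPf -> _].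
  by [].
rewrite eqX; case: ifP => mus; first by rewrite (big_rem mu).
by rewrite add0r rem_id ?mus.
Qed.

End LinClosed.

Lemma expfz_eq1_nat (F : fieldType) (p : F) :
  (forall k : nat, (0 < k)%N -> p ^+ k != 1) -> forall a : int, p ^ a = 1 -> a = 0.
Proof.
move=> hp a; case: (intP a) => // k pk.
  by have := hp k.+1 isT; rewrite exprnP pk eqxx.
have := hp k.+1 isT; rewrite -[p ^+ _]invrK exprnN pk.
by rewrite invr1 eqxx.
Qed.

Lemma expfz_inj (F : fieldType) (p : F) : p != 0 ->
  (forall k : nat, (0 < k)%N -> p ^+ k != 1) -> injective (fun a : int => p ^ a).
Proof.
move=> p0 hp a b /= eab; apply/eqP; rewrite -subr_eq0; apply/eqP.
apply: (expfz_eq1_nat hp); rewrite expfzDr // -invr_expz eab mulfV //.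
exact: expfz_neq0.
Qed.

(** * Weight spaces and graded submodules *)

Section WeakModules.
Variables (F : fieldType) (n : nat).
Local Notation wt := 'rV[int]_n.
Implicit Types (mu nu : wt) (i j : 'I_n).

(* A module over the quantum (super)algebra without the Serre relations. *)
Record weak_module (odd_idx : 'I_n -> bool) (p : F) (N : nat)
    (V : gaction F n N) : Prop := WeakModule {
  wm_parity : forall x, parity_mx F (parity V) *m V x
    = (-1) ^+ gparity odd_idx x *: (V x *m parity_mx F (parity V));
  wm_KK : forall i j, V (gK i) *m V (gK j) = V (gK j) *m V (gK i);
  wm_KKV : forall i, V (gK i) *m V (gKV i) = 1%:M;
  wm_KVK : forall i, V (gKV i) *m V (gK i) = 1%:M;
  wm_KE : forall i j, V (gK i) *m V (gE j)
    = p ^ dot (alpha i) (alpha j) *: (V (gE j) *m V (gK i));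
  wm_KF : forall i j, V (gK i) *m V (gF j)
    = p ^ (- dot (alpha i) (alpha j)) *: (V (gF j) *m V (gK i));
  wm_EF : forall i j, V (gE i) *m V (gF j)
      - (-1) ^+ (odd_idx i && odd_idx j) *: (V (gF j) *m V (gE i))
    = if i == j then (p - p^-1)^-1 *: (V (gK i) - V (gKV i)) else 0
}.

Lemma module_weak (odd_idx : 'I_n -> bool) (p : F) (N : nat)
    (V : gaction F n N) : is_module odd_idx p V -> weak_module odd_idx p V.
Proof.
case=> h1 h2 h3 h4 h5 h6 h7 _ _; split=> // i j.
  by rewrite scalemxAl -h5 -(mulmxA _ (V (gKV i))) h4 mulmx1.
by rewrite scalemxAl -h6 -(mulmxA _ (V (gKV i))) h4 mulmx1.
Qed.

Section KWeights.
Variables (p : F) (N : nat) (V : gaction F n N).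
Hypotheses (p0 : p != 0) (pnr : forall k : nat, (0 < k)%N -> p ^+ k != 1).
Implicit Types x y : 'cV[F]_N.

Definition k_weight mu x := forall i, V (gK i) *m x = p ^ dot (alpha i) mu *: x.

Lemma k_weight_graded : graded k_weight.
Proof.
move=> mu; split=> [i|x y hx hy i|c x hx i].
- by rewrite mulmx0 scaler0.
- by rewrite mulmxDr hx hy scalerDr.
- by rewrite -scalemxAr hx !scalerA mulrC.
Qed.

(** Distinct weights are separated by some [k_i], as the simple roots span and [p] is not a root of
    unity; this is the usual independence of eigenvectors. *)
Lemma k_weight_indep (s : seq wt) (X : wt -> 'cV[F]_N) :
  uniq s -> (forall mu, k_weight mu (X mu)) -> \sum_(mu <- s) X mu = 0 ->
  forall mu, mu \in s -> X mu = 0.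
Proof.
elim: s X => // nu s IH X /= /andP[nus us] hX; rewrite big_cons => sum0.
have Xs mu : mu \in s -> X mu = 0.
  move=> mus; have [i neq] : exists i, dot (alpha i) mu <> dot (alpha i) nu.
    apply: contrapT => h; move: nus; suff <- : mu = nu by rewrite mus.
    apply: dot_alpha_inj => i; apply: contrapT => hi; apply: h; by exists i.
  (* The scalar by which [V (gK i)] minus its eigenvalue at [nu] acts on weight [ka]; this operator
     removes [X nu] from the sum, so the induction hypothesis applies. *)
  pose c ka := p ^ dot (alpha i) ka - p ^ dot (alpha i) nu.
  have /(_ mu mus)/eqP : forall ka, ka \in s -> c ka *: X ka = 0.
    apply: IH => // [ka|].
      by apply: (linZ (k_weight_graded ka)); apply: hX.
    have : V (gK i) *m (X nu + \sum_(ka <- s) X ka)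
        - p ^ dot (alpha i) nu *: (X nu + \sum_(ka <- s) X ka) = 0.
      by rewrite sum0 mulmx0 scaler0 subr0.
    rewrite mulmxDr hX scalerDr opprD addrACA subrr add0r mulmx_sumr scaler_sumr.
    rewrite -sumrB => {2}<-; apply: eq_bigr => ka _.
    by rewrite hX scalerBl.
  rewrite scaler_eq0 subr_eq0 => /orP[/eqP/(expfz_inj p0 pnr)//|/eqP].
  by [].
move=> mu; rewrite inE => /orP[/eqP->|]; last exact: Xs.
by move: sum0; rewrite big1_seq ?addr0 // => ka /andP[_]; apply: Xs.
Qed.

(** Moving [x] to the other side of its decomposition leaves a vanishing sum of weight vectors, so
    by independence the component at [mu] is [x] itself. *)
Lemma gspan_k_weight (P : wt -> 'cV[F]_N -> Prop) mu x : graded P ->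
  (forall nu y, P nu y -> k_weight nu y) ->
  gspan P x -> k_weight mu x -> P mu x.
Proof.
move=> gP hP /(gspan_fin gP) [s [X [us PX ->]]] hx.
set x0 := \sum_(_ <- _) _ in hx *.
pose s' := mu :: rem mu s.
pose X' nu := if nu == mu then (if mu \in s then X mu else 0) - x0 else X nu.
have us' : uniq s' by rewrite /= rem_uniq // mem_rem_uniq // !inE eqxx.
have hX' nu : k_weight nu (X' nu).
  rewrite /X'; case: eqP => [->|_]; last exact: hP.
  apply: (linB (k_weight_graded mu)) => //; case: ifP => _; first exact: hP.
  exact: (lin0 (k_weight_graded mu)).
have sum0 : \sum_(nu <- s') X' nu = 0.
  rewrite big_cons {1}/X' eqxx.
  have -> : \sum_(nu <- rem mu s) X' nu = \sum_(nu <- rem mu s) X nu.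
    apply: eq_big_seq => nu; rewrite mem_rem_uniq // !inE /X'.
    by move=> /andP[/negPf -> _].
  case: ifP => mus; first by rewrite addrAC /x0 (big_rem mu mus) subrr.
  by rewrite sub0r rem_id ?mus // addNr.
have := k_weight_indep us' hX' sum0 (mem_head _ _).
rewrite /X' eqxx => /eqP; rewrite subr_eq0 => /eqP <-.
by case: ifP => _ //; apply: (lin0 (gP _)).
Qed.

End KWeights.

(* [ep] is the scalar by which the parity operator acts per unit of the
   coordinate sum of the weight: -1 for osp, 1 for so. *)
Definition is_wt (p ep : F) (N : nat) (V : gaction F n N) mu (x : 'cV[F]_N) :=
  k_weight p V mu x /\ parity_mx F (parity V) *m x = ep ^ wsum mu *: x.

Lemma is_wt_graded p ep N (V : gaction F n N) : graded (is_wt p ep V).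
Proof.
move=> mu; split=> [|x y [hx px] [hy py]|c x [hx px]].
- split; first exact: (lin0 (k_weight_graded p V mu)).
  by rewrite mulmx0 scaler0.
- split; first exact: (linD (k_weight_graded p V mu)).
  by rewrite mulmxDr px py scalerDr.
- split; first exact: (linZ (k_weight_graded p V mu)).
  by rewrite -scalemxAr px !scalerA mulrC.
Qed.

Section WeakModule.
Variables (odd_idx : 'I_n -> bool) (p ep : F) (N : nat) (V : gaction F n N).
Hypotheses (p0 : p != 0) (pnr : forall k : nat, (0 < k)%N -> p ^+ k != 1).
Hypothesis ep0 : ep != 0.
Hypothesis ep_alpha : forall i, ep ^ wsum (alpha i) = (-1) ^+ odd_idx i.
Hypothesis VP : weak_module odd_idx p V.
Implicit Types x y : 'cV[F]_N.

Lemma is_wt_E mu i x :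
  is_wt p ep V mu x -> is_wt p ep V (mu + alpha i) (V (gE i) *m x).
Proof.
move=> [hx px]; split=> [j|].
  rewrite mulmxA (wm_KE VP) -scalemxAl -mulmxA hx -scalemxAr scalerA.
  by rewrite dotDr expfzDr // mulrC.
rewrite mulmxA (wm_parity VP) -scalemxAl -mulmxA px -scalemxAr scalerA.
by rewrite wsumD expfzDr // ep_alpha mulrC.
Qed.

Lemma is_wt_F mu i x :
  is_wt p ep V mu x -> is_wt p ep V (mu - alpha i) (V (gF i) *m x).
Proof.
move=> [hx px]; split=> [j|].
  rewrite mulmxA (wm_KF VP) -scalemxAl -mulmxA hx -scalemxAr scalerA.
  by rewrite dotBr expfzDr // mulrC.
rewrite mulmxA (wm_parity VP) -scalemxAl -mulmxA px -scalemxAr scalerA.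
by rewrite wsumD wsumN expfzDr // -invr_expz ep_alpha invr_sign mulrC.
Qed.

Lemma k_weight_KV mu i x :
  k_weight p V mu x -> V (gKV i) *m x = p ^ (- dot (alpha i) mu) *: x.
Proof.
move=> hx; rewrite -[x in LHS](scalerK (expfz_neq0 (dot (alpha i) mu) p0)).
by rewrite -hx -scalemxAr mulmxA (wm_KVK VP) mul1mx invr_expz.
Qed.

Lemma wt_EF mu i j x : is_wt p ep V mu x ->
  V (gE i) *m (V (gF j) *m x)
    = (-1) ^+ (odd_idx i && odd_idx j) *: (V (gF j) *m (V (gE i) *m x))
      + (if i == j then (p ^ dot (alpha i) mu - p ^ (- dot (alpha i) mu))
                          / (p - p^-1) else 0) *: x.
Proof.
move=> [hx _]; rewrite !mulmxA scalemxAl addrC; apply/eqP.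
rewrite -subr_eq -mulmxBl (wm_EF VP); case: (i =P j) => _; last first.
  by rewrite mul0mx scale0r.
rewrite -scalemxAl mulmxBl hx (k_weight_KV _ hx) -scalerBl scalerA.
by rewrite [X in X *: _]mulrC.
Qed.

Section Family.
Variables (P : wt -> 'cV[F]_N -> Prop) (U : {vspace 'cV[F]_N}).
Hypotheses (gP : graded P) (P_wt : forall mu x, P mu x -> is_wt p ep V mu x).
Hypothesis P_E : forall mu i x, P mu x -> P (mu + alpha i) (V (gE i) *m x).
Hypothesis P_F : forall mu i x, P mu x -> P (mu - alpha i) (V (gF i) *m x).
Hypothesis P_U : forall mu x, P mu x -> x \in U.
Hypothesis irrU : irreducible V U.

(** Stability under [e_i] and [f_i] suffices: on weight vectors the [k_i] and the parity operator
    are scalars. *)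
Lemma gspan_submodule :
  exists W, submodule V W /\ forall x, x \in W <-> gspan P x.
Proof.
have [W hW] := lin_closed_vspace (gspan_lin gP).
exists W; split=> //; split=> [z v /hW Pv|v /hW Pv]; apply/hW; last first.
  apply: (gspan_map (g := id)) Pv => [|x y|mu x Px]; rewrite ?mulmx0 ?mulmxDr //.
  by rewrite (P_wt Px).2; apply: (linZ (gP mu)).
have mapV (g : wt -> wt) :
    (forall mu x, P mu x -> P (g mu) (V z *m x)) -> gspan P (V z *m v).
  by move=> h; apply: (gspan_map (g := g)) Pv => [|x y|//];
    rewrite ?mulmx0 ?mulmxDr.
case: z mapV => i mapV.
- exact: (mapV (fun mu => mu + alpha i) (fun mu => @P_E mu i)).
- exact: (mapV (fun mu => mu - alpha i) (fun mu => @P_F mu i)).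
- apply: (mapV id) => mu x Px; rewrite (P_wt Px).1; exact: (linZ (gP mu)).
- apply: (mapV id) => mu x Px; rewrite (k_weight_KV _ (P_wt Px).1).
  exact: (linZ (gP mu)).
Qed.

Lemma gspan_irreducible :
  (forall x, x \in U <-> gspan P x) \/ (forall mu x, P mu x -> x = 0).
Proof.
have [W [subW hW]] := gspan_submodule.
have [_ _ /(_ W subW) irr] := irrU.
have /irr [] : (W <= U)%VS.
- apply/subvP => x /hW; apply: (gspan_sub (Q := fun y => y \in U)) => //.
  by split=> [|y z|c y]; [apply: mem0v | apply: memvD | apply: memvZ].
- move=> W0; right=> mu x /gspan_in /hW; rewrite W0 memv0 => /eqP //.
- by move=> WU; left; rewrite -WU.
Qed.

Lemma irreducible_gspan mu v : P mu v -> v != 0 ->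
  forall x, x \in U -> gspan P x.
Proof.
move=> Pv v0 x xU; have [h|h] := gspan_irreducible; first exact/h.
by rewrite (h _ _ Pv) eqxx in v0.
Qed.

(** By irreducibility the family spans [U] or vanishes, and spanning would put [v] in [P mu] by
    [gspan_k_weight]. *)
Lemma irreducible_eq0 mu v : v \in U -> k_weight p V mu v -> ~ P mu v ->
  forall nu x, P nu x -> x = 0.
Proof.
move=> vU kv nPv; have [h|//] := gspan_irreducible.
case: nPv; apply: (gspan_k_weight p0 pnr gP _ _ kv); last exact/h.
by move=> nu y /P_wt [].
Qed.

End Family.

Lemma is_wt_gspan (U : {vspace 'cV[F]_N}) mu v : irreducible V U -> U = fullv ->
  v != 0 -> is_wt p ep V mu v -> forall x, gspan (is_wt p ep V) x.
Proof.
move=> irrU Uf v0 hv x.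
apply: (@irreducible_gspan (is_wt p ep V) U _ _ _ _ _ irrU mu v) => //.
- exact: is_wt_graded.
- exact: is_wt_E.
- exact: is_wt_F.
- by move=> *; rewrite Uf memvf.
- by rewrite Uf memvf.
Qed.

(** Where such vectors span, the weight determines the parity. This supplies the parity of highest
    weight vectors, about which [irreducible_hw] says nothing. *)
Lemma k_weight_is_wt mu x : gspan (is_wt p ep V) x -> k_weight p V mu x ->
  is_wt p ep V mu x.
Proof.
by apply: gspan_k_weight => //; [apply: is_wt_graded | move=> nu y []].
Qed.

Lemma k_two_rho_wt mu x : k_weight p V mu x ->
  k_two_rho V *m x = p ^ dot (two_rho n) mu *: x.
Proof.
move=> hx; rewrite /k_two_rho two_rhoE.
have hX i (c : nat) : (V (gK i) ^+ c : 'M_N) *m x = p ^ dot (alpha i *+ c) mu *: x.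
  elim: c => [|c IH].
    by rewrite expr0 mul1mx mulr0n dot0l expr0z scale1r.
  rewrite exprS -[_ * _]/(_ *m _) -mulmxA IH -scalemxAr hx scalerA.
  by rewrite -expfzDr // mulrS [dot (_ + _) _]dotC dotDr !(dotC mu) addrC.
pose Q (A : 'M[F]_N) (u : wt) := A *m x = p ^ dot u mu *: x.
suff : Q (\prod_(i < n) V (gK i) ^+ two_rho_coef i)
         (\sum_i alpha i *+ two_rho_coef i) by [].
elim/big_rec2: _ => [|i u A _ IH]; first by rewrite /Q mul1mx dot0l expr0z scale1r.
rewrite /Q -[_ * _]/(_ *m _) -mulmxA IH -scalemxAr hX scalerA -expfzDr //.
by rewrite [dot (_ + _) _]dotC dotDr !(dotC mu) addrC.
Qed.

End WeakModule.
End WeakModules.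

(** * Comparing irreducible modules of the two algebras *)

(** An isomorphism from [U1] to [U2] carrying [D1] to [D2], recorded by its graph: a relation
    generated by a pair of vectors need not be known in advance to be a function. *)
Record iso_graph (F : fieldType) (N1 N2 : nat)
    (U1 : {vspace 'cV[F]_N1}) (U2 : {vspace 'cV[F]_N2})
    (D1 : 'M[F]_N1) (D2 : 'M[F]_N2) (G : 'cV[F]_N1 * 'cV[F]_N2 -> Prop)
    : Prop := IsoGraph {
  ig_lin : lin_closed G;
  ig_sub : forall x y, G (x, y) -> x \in U1 /\ y \in U2;
  ig_total1 : forall x, x \in U1 -> exists y, G (x, y);
  ig_total2 : forall y, y \in U2 -> exists x, G (x, y);
  ig_inj1 : forall x, G (x, 0) -> x = 0;
  ig_inj2 : forall y, G (0, y) -> y = 0;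
  ig_stable : forall x y, G (x, y) -> G (D1 *m x, D2 *m y)
}.

Section Correspondence.
Variables (F : fieldType) (n : nat) (q : F).
Hypotheses (q0 : q != 0) (qnr : forall k : nat, (0 < k)%N -> q ^+ k != 1).
Local Notation wt := 'rV[int]_n.
Implicit Types (mu nu : wt) (i j : 'I_n).

Let sgn (a : int) : F := (-1) ^ a.

Let sgnD a b : sgn (a + b) = sgn a * sgn b.
Proof. by rewrite /sgn expfzDr // oppr_eq0 oner_eq0. Qed.

Let sgnN a : sgn (- a) = sgn a.
Proof.
rewrite /sgn; case: (intP a) => [|k|k]; rewrite ?oppr0 ?opprK //.
  by rewrite -exprnN invr_sign.
by rewrite -exprnN invr_sign.
Qed.

Let sgnK a : sgn a * sgn a = 1.
Proof. by rewrite -{2}(sgnN a) -sgnD subrr. Qed.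

Let sgn_odd (k : nat) : odd k -> sgn k%:Z = -1.
Proof. by move=> ok; rewrite /sgn -exprnP -signr_odd ok. Qed.

Lemma osp_ep_alpha i : (-1 : F) ^ wsum (alpha i) = (-1) ^+ osp_odd i.
Proof. by rewrite wsum_alpha /osp_odd; case: eqP. Qed.

Lemma so_ep_alpha i : (1 : F) ^ wsum (alpha i) = (-1) ^+ so_odd i.
Proof. by rewrite exp1rz. Qed.

Lemma expNz (a : int) : (- q) ^ a = sgn a * q ^ a.
Proof.
rewrite /sgn; case: (intP a) => [|k|k]; first by rewrite !expr0z mulr1.
  by rewrite -!exprnP (exprNn q).
by rewrite -!exprnN (exprNn q) invfM.
Qed.

Lemma nonroot_opp (k : nat) : (0 < k)%N -> (- q) ^+ k != 1.
Proof.
move=> k0; apply/negP => /eqP h; have := qnr (k := (k * 2)%N).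
by rewrite muln_gt0 k0 exprM -(sqrrN (q ^+ k)) => /(_ isT);
  rewrite exprNn in h; have /eqP := congr1 (fun z => z ^+ 2) h;
  rewrite exprMn sqrr_sign mul1r expr1n sqrrN => /eqP ->; rewrite eqxx.
Qed.

(** With these signs on weight [mu], the operators [E_i] and [F_i] of so at [- q] obey the osp
    commutation relation at [q]; [sEF_comm] and [sEF_diag] are the identities behind this. *)
Let sE i mu : F := sgn (dot (eps n i) mu).
Let sF i mu : F := sgn (dot (eps n i.+1) mu).

(** The total exponent (eps_i, alpha_j) + (eps_(j+1), alpha_i) is 0, except that it is 1 when i = j
    is the last index: exactly the osp anticommutation sign. *)
Let sEF_comm i j mu :
  sE i (mu - alpha j) * sF j mu
    = (-1) ^+ (osp_odd i && osp_odd j) * (sF j (mu + alpha i) * sE i mu).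
Proof.
rewrite /sE /sF !dotDr dotNr !sgnD sgnN.
suff -> : sgn (dot (eps n i) (alpha j))
    = (-1) ^+ (osp_odd i && osp_odd j) * sgn (dot (eps n j.+1) (alpha i)).
  ring.
rewrite !alphaE !dotBr !dot_eps ltn_ord !andbT eqSS (eq_sym _ (nat_of_ord i)).
have osp_ord k : @osp_odd n k = ~~ (k.+1 < n)%N.
  by rewrite /osp_odd -leqNgt eqn_leq ltn_ord.
rewrite !osp_ord; have [->|neq_ij] := eqVneq i j.
  rewrite (ltn_eqF (ltnSn j)) eqxx subr0 sub0r andbb.
  case: ltnP => _ /=; rewrite sgnN ?mul1r //.
  by rewrite (sgn_odd (k := 1)) // /sgn expr0z mulr1.
have nij : (nat_of_ord i == j) = false by rewrite (inj_eq val_inj) (negPf neq_ij).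
rewrite nij (eq_sym (nat_of_ord j)) nij !subr0.
have [ij|neq_ij1] := eqVneq (nat_of_ord i) j.+1.
  by rewrite -ij ltn_ord andbF /= sub0r sgnN mul1r.
rewrite /= !subr0 mulr1.
have [] := ltnP i.+1 n; rewrite //= => ni.
have [] := ltnP j.+1 n; rewrite //= => nj.
by case/eqP: neq_ij; apply: val_inj; have := ltn_ord i; have := ltn_ord j; lia.
Qed.

(** This sign compensates the change of [(p ^ a - p ^ (- a)) / (p - p^-1)] between [p = - q] and
    [p = q], with a = (alpha_i, mu). *)
Let sEF_diag i mu : sE i (mu - alpha i) * sF i mu = - sgn (dot (alpha i) mu).
Proof.
rewrite /sE /sF dotBr alphaE dotBr dotBl !dot_eps eqxx ltn_ord.
rewrite (negPf (_ : nat_of_ord i != i.+1)) ?subr0; last by rewrite neq_ltn leqnn.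
by rewrite !sgnD !sgnN (sgn_odd (k := 1)) // mulrN1 mulNr.
Qed.

Variables (N1 N2 : nat) (V1 : gaction F n N1) (V2 : gaction F n N2).
Hypotheses (V1P : weak_module (@osp_odd n) q V1)
           (V2P : weak_module (@so_odd n) (- q) V2).
Variables (lambda : wt) (v1 : 'cV[F]_N1) (v2 : 'cV[F]_N2).
Variables (U1 : {vspace 'cV[F]_N1}) (U2 : {vspace 'cV[F]_N2}).
Hypotheses (irrU1 : irreducible V1 U1) (irrU2 : irreducible V2 U2).
Hypotheses (v1U : v1 \in U1) (v2U : v2 \in U2).
Hypotheses (v1_neq0 : v1 != 0) (v2_neq0 : v2 != 0).
Hypotheses (v1E : forall i, V1 (gE i) *m v1 = 0)
           (v2E : forall i, V2 (gE i) *m v2 = 0).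
Hypotheses (v1wt : is_wt q (-1) V1 lambda v1) (v2wt : is_wt (- q) 1 V2 lambda v2).

Local Notation cV12 := ('cV[F]_N1 * 'cV[F]_N2)%type.

(* The graph of the isomorphism, weight by weight: applying f_i (or e_i) on
   both sides introduces a sign depending on the weight. *)
Inductive corr : wt -> cV12 -> Prop :=
| corr_hw : corr lambda (v1, v2)
| corr_0 mu : corr mu 0
| corr_D mu x y : corr mu x -> corr mu y -> corr mu (x + y)
| corr_Z mu c x : corr mu x -> corr mu (c *: x)
| corr_F mu i x : corr mu x ->
    corr (mu - alpha i) (V1 (gF i) *m x.1, sF i mu *: (V2 (gF i) *m x.2)).

Let corr_graded : graded corr.
Proof. by move=> mu; split; [apply: corr_0|apply: corr_D|apply: corr_Z]. Qed.

Let opp_q0 : - q != 0. Proof. by rewrite oppr_eq0. Qed.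
Let ep10 : (-1 : F) != 0. Proof. by rewrite oppr_eq0 oner_eq0. Qed.

Lemma corr_wt mu x : corr mu x ->
  is_wt q (-1) V1 mu x.1 /\ is_wt (- q) 1 V2 mu x.2.
Proof.
elim=> {mu x} [|mu|mu x y _ [x1 x2] _ [y1 y2]|mu c x _ [x1 x2]|mu i x _ [x1 x2]] //.
- by split; apply: (lin0 (is_wt_graded _ _ _ mu)).
- by split; apply: (linD (is_wt_graded _ _ _ mu)).
- by split; apply: (linZ (is_wt_graded _ _ _ mu)).
split; first exact: (is_wt_F q0 ep10 osp_ep_alpha V1P).
apply: (linZ (is_wt_graded _ _ _ _)).
exact: (is_wt_F opp_q0 (oner_neq0 _) so_ep_alpha V2P).
Qed.

Lemma corr_mem mu x : corr mu x -> x.1 \in U1 /\ x.2 \in U2.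
Proof.
have [[[sU1 _] _ _] [[sU2 _] _ _]] := (irrU1, irrU2).
elim=> {mu x} [|mu|mu x y _ [x1 x2] _ [y1 y2]|mu c x _ [x1 x2]|mu i x _ [x1 x2]] //=.
- by rewrite !mem0v.
- by rewrite !memvD.
- by rewrite !memvZ.
by rewrite sU1 ?memvZ ?sU2.
Qed.

Let corr_DZ c mu x1 x2 y1 y2 : corr mu (x1, x2) -> corr mu (y1, y2) ->
  corr mu (c *: x1 + y1, c *: x2 + y2).
Proof. by move=> Cx Cy; apply: (corr_D (corr_Z c Cx) Cy). Qed.

(** Only the [f_i] generate [corr]; an [e_i] is commuted past the last [f_j], and the sign
    identities match the two resulting terms on both sides. *)
Lemma corr_E mu i x : corr mu x ->
  corr (mu + alpha i) (V1 (gE i) *m x.1, sE i mu *: (V2 (gE i) *m x.2)).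
Proof.
elim=> {mu x} [|mu|mu x y _ IHx _ IHy|mu c x _ IHx|mu j x Cx IHx] /=.
- by rewrite v1E v2E scaler0; apply: corr_0.
- by rewrite !mulmx0 scaler0; apply: corr_0.
- by rewrite !mulmxDr scalerDr; apply: (corr_D IHx IHy).
- rewrite -!scalemxAr scalerA mulrC -scalerA; exact: (corr_Z c IHx).
have [x1wt x2wt] := corr_wt Cx.
rewrite -scalemxAr.
rewrite (wt_EF q0 V1P _ _ x1wt) (wt_EF opp_q0 V2P _ _ x2wt) /= expr0 scale1r.
have := corr_F j IHx; rewrite /= -scalemxAr addrAC => Cfe.
(* The scalar by which the (super)commutator of [e_i] and [f_j] acts on weight [mu], at parameter
   [p]. *)
pose b (p : F) := if i == j then
  (p ^ dot (alpha i) mu - p ^ (- dot (alpha i) mu)) / (p - p^-1) else 0.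
have Cb : corr (mu - alpha j + alpha i)
    (b q *: x.1, (sE i (mu - alpha j) * sF j mu * b (- q)) *: x.2).
  rewrite /b; case: eqP => [<-|_]; last first.
    by rewrite mulr0 !scale0r; apply: corr_0.
  rewrite subrK sEF_diag !expNz sgnN -mulrBr invrN -opprD invrN mulrA.
  rewrite mulNr mulrNN !mulrA sgnK mul1r.
  exact: (corr_Z _ Cx).
have := corr_DZ ((-1) ^+ (osp_odd i && osp_odd j)) Cfe Cb.
by rewrite !scalerDr !scalerA !sEF_comm !mulrA.
Qed.

Lemma corr_top mu x : corr mu x ->
  (dot (two_rho n) lambda < dot (two_rho n) mu -> x = 0) /\
  (dot (two_rho n) lambda = dot (two_rho n) mu -> exists c, x = c *: (v1, v2)).
Proof.
elim=> {mu x} [|mu|mu x y _ [x1 x2] _ [y1 y2]|mu c x _ [x1 x2]|mu i x _ [x1 x2]].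
- by rewrite ltxx; split=> // _; exists 1; rewrite scale1r.
- by split=> // _; exists 0; rewrite scale0r.
- split=> h; first by rewrite x1 ?y1 ?addr0.
  have [[a ->] [b ->]] := (x2 h, y2 h).
  by exists (a + b); rewrite scalerDl.
- split=> h; first by rewrite x1 ?scaler0.
  by have [a ->] := x2 h; exists (c * a); rewrite scalerA.
have ai := dot_two_rho_alpha i; rewrite dotBr.
(* If the image under [f_i] is at least as high as [lambda], then [x] lies strictly above and
   vanishes by induction. *)
have x0 : dot (two_rho n) lambda <= dot (two_rho n) mu - dot (two_rho n) (alpha i) ->
    (V1 (gF i) *m x.1, sF i mu *: (V2 (gF i) *m x.2)) = 0 :> cV12.
  by move=> h; rewrite x1 ?mulmx0 ?scaler0 //; lia.
by split=> h; [rewrite x0 // ltW | exists 0; rewrite x0 ?scale0r // h].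
Qed.

Lemma corr_lambda x : corr lambda x -> exists c, x = c *: (v1, v2).
Proof. by move=> /corr_top [_]; apply. Qed.

(** The vectors [y] with [(y, 0)] in the correspondence form a stable family in [U1] that misses
    [v1], since [corr lambda] holds only multiples of [(v1, v2)] and [v2] is non-zero;
    irreducibility then kills it. *)
Lemma corr_inj1 mu x : corr mu (x, 0) -> x = 0.
Proof.
pose P nu y := corr nu (y, 0 : 'cV[F]_N2).
apply: (@irreducible_eq0 F n (@osp_odd n) q (-1) N1 V1 q0 qnr V1P P U1
  _ _ _ _ _ irrU1 lambda v1) => //.
- move=> nu; split=> [|y z Py Pz|c y Py]; first exact: corr_0.
    by have := corr_D Py Pz; rewrite /P -[(y, 0) + _]/(y + z, 0 + 0) addr0.
  by have := corr_Z c Py; rewrite /P -[c *: (y, 0)]/(c *: y, c *: 0) scaler0.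
- by move=> nu y /corr_wt [].
- by move=> nu i y /(corr_E i) /=; rewrite mulmx0 scaler0.
- by move=> nu i y /(corr_F i) /=; rewrite mulmx0 scaler0.
- by move=> nu y /corr_mem [].
- by have [] := v1wt.
case/corr_lambda => c [e1 /esym/eqP]; rewrite scaler_eq0 (negPf v2_neq0) orbF.
by move=> /eqP c0; move: v1_neq0; rewrite e1 c0 scale0r eqxx.
Qed.

Lemma corr_inj2 mu y : corr mu (0, y) -> y = 0.
Proof.
pose P nu z := corr nu (0 : 'cV[F]_N1, z).
have PZ nu c z : P nu z -> P nu (c *: z).
  by move=> /(corr_Z c); rewrite /P -[c *: (0, z)]/(c *: 0, c *: z) scaler0.
(* On the second side the operators carry signs; a sign is its own inverse, so rescaling strips
   it. *)
have sgnZ a nu z : P nu (sgn a *: z) -> P nu z.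
  by move=> /(PZ _ (sgn a)); rewrite scalerA sgnK scale1r.
apply: (@irreducible_eq0 F n (@so_odd n) (- q) 1 N2 V2 opp_q0 nonroot_opp V2P P U2
  _ _ _ _ _ irrU2 lambda v2) => //.
- move=> nu; split=> [|z w Pz Pw|c z Pz]; [exact: corr_0| |exact: PZ].
  by have := corr_D Pz Pw; rewrite /P -[(0, z) + _]/(0 + 0, z + w) addr0.
- by move=> nu z /corr_wt [].
- by move=> nu i z /(corr_E i) /=; rewrite mulmx0; apply: sgnZ.
- by move=> nu i z /(corr_F i) /=; rewrite mulmx0; apply: sgnZ.
- by move=> nu z /corr_mem [].
- by have [] := v2wt.
case/corr_lambda => c [/esym/eqP]; rewrite scaler_eq0 (negPf v1_neq0) orbF.
by move=> /eqP c0 e2; move: v2_neq0; rewrite e2 c0 scale0r eqxx.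
Qed.

(** The first coordinates span a submodule of [U1] containing [v1], hence all of [U1]. *)
Let gspan_corr_fst x : x \in U1 -> exists y, gspan corr (x, y).
Proof.
pose P nu z := exists w, corr nu (z, w).
have gP : graded P.
  move=> nu; split=> [|z w [z' Pz] [w' Pw]|c z [z' Pz]].
  - by exists 0; apply: corr_0.
  - by exists (z' + w'); apply: (corr_D Pz Pw).
  - by exists (c *: z'); apply: (corr_Z c Pz).
suff : x \in U1 -> gspan P x.
  move=> h /h; elim=> [|nu x1 z [y Px] _ [w Pz]]; first by exists 0; apply: gspan0.
  by exists (y + w); apply: (gspan_cons Px Pz).
apply: (@irreducible_gspan F n (@osp_odd n) q (-1) N1 V1 q0 V1P P U1 _ _ _ _ _ irrU1
  lambda v1) => //.
- by move=> nu y [w /corr_wt []].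
- by move=> nu i y [w /(corr_E i) Pw]; eexists; apply: Pw.
- by move=> nu i y [w /(corr_F i) Pw]; eexists; apply: Pw.
- by move=> nu y [w /corr_mem []].
- by exists v2; apply: corr_hw.
Qed.

Let gspan_corr_snd y : y \in U2 -> exists x, gspan corr (x, y).
Proof.
pose P nu z := exists w, corr nu (w, z).
have gP : graded P.
  move=> nu; split=> [|z w [z' Pz] [w' Pw]|c z [z' Pz]].
  - by exists 0; apply: corr_0.
  - by exists (z' + w'); apply: (corr_D Pz Pw).
  - by exists (c *: z'); apply: (corr_Z c Pz).
have sgnZ a nu z : P nu (sgn a *: z) -> P nu z.
  by move=> /(linZ (gP nu) (sgn a)); rewrite scalerA sgnK scale1r.
suff : y \in U2 -> gspan P y.
  move=> h /h; elim=> [|nu y1 z [x Px] _ [w Pz]]; first by exists 0; apply: gspan0.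
  by exists (x + w); apply: (gspan_cons Px Pz).
apply: (@irreducible_gspan F n (@so_odd n) (- q) 1 N2 V2 opp_q0 V2P P U2 _ _ _ _ _
  irrU2 lambda v2) => //.
- by move=> nu z [w /corr_wt []].
- by move=> nu i z [w /(corr_E i) Pw]; apply: sgnZ; eexists; apply: Pw.
- by move=> nu i z [w /(corr_F i) Pw]; apply: sgnZ; eexists; apply: Pw.
- by move=> nu z [w /corr_mem []].
- by exists v1; apply: corr_hw.
Qed.

(* The coordinates of 2 rho are odd, so q^(2 rho, mu) and (-q)^(2 rho, mu)
   differ by the parity of mu. *)
Let sgn_two_rho mu : sgn (dot (two_rho n) mu) = sgn (wsum mu).
Proof.
rewrite /dot /wsum; apply: (big_ind2 (fun a b => sgn a = sgn b)) => //.
  by move=> a b c d; rewrite !sgnD => -> ->.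
move=> i _; rewrite mxE /two_rho_coord.
have -> : (2 * (n - i) - 1 = (n - i).-1 + (n - i).-1 + 1)%N.
  by have := ltn_ord i; lia.
rewrite !PoszD !mulrDl mul1r.
by rewrite !sgnD sgnK mul1r.
Qed.

Let D1 := parity_mx F (parity V1) *m k_two_rho V1.
Let D2 := parity_mx F (parity V2) *m k_two_rho V2.

Lemma corr_D12 mu x : corr mu x -> corr mu (D1 *m x.1, D2 *m x.2).
Proof.
move=> Cx; have [[k1 p1] [k2 p2]] := corr_wt Cx.
rewrite /D1 /D2 -!mulmxA (k_two_rho_wt q0 k1) (k_two_rho_wt opp_q0 k2).
rewrite -!scalemxAr p1 p2.
rewrite exp1rz scale1r expNz sgn_two_rho scalerA mulrC.
exact: corr_Z.
Qed.

Lemma gspan_corr_iso_graph : iso_graph U1 U2 D1 D2 (gspan corr).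
Proof.
have linG := gspan_lin corr_graded.
have linU (N : nat) (U : {vspace 'cV[F]_N}) : lin_closed (fun x => x \in U).
  by split=> [|x y|c x]; [apply: mem0v | apply: memvD | apply: memvZ].
have fstE (I : Type) (s : seq I) (X : I -> cV12) :
    (\sum_(a <- s) X a).1 = \sum_(a <- s) (X a).1.
  by elim/big_rec2: _ => //= a x y _ ->.
have sndE (I : Type) (s : seq I) (X : I -> cV12) :
    (\sum_(a <- s) X a).2 = \sum_(a <- s) (X a).2.
  by elim/big_rec2: _ => //= a x y _ ->.
split=> //.
- move=> x y Gxy; suff : (x, y).1 \in U1 /\ (x, y).2 \in U2 by [].
  apply: (gspan_sub (Q := fun z : cV12 => z.1 \in U1 /\ z.2 \in U2)) Gxy.
    split=> [|z w [z1 z2] [w1 w2]|c z [z1 z2]]; first by split; apply: mem0v.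
      by split; apply: memvD.
    by split; apply: memvZ.
  exact: corr_mem.
- move=> x /(gspan_fin corr_graded) [s [X [us CX eX]]].
  (* Independence of weights in [V2] makes each second coordinate vanish, which reduces injectivity
     to single weights. *)
  have e20 : forall mu, mu \in s -> (X mu).2 = 0.
    apply: (k_weight_indep (V := V2) opp_q0 nonroot_opp us) => [mu|].
      by have [_ []] := corr_wt (CX mu).
    by rewrite -sndE -eX.
  have /= -> := congr1 fst eX; rewrite fstE big1_seq // => mu /andP[_ /e20 e2].
  by apply: (corr_inj1 (mu := mu)); rewrite -e2 -surjective_pairing.
- move=> y /(gspan_fin corr_graded) [s [X [us CX eX]]].
  have e10 : forall mu, mu \in s -> (X mu).1 = 0.
    apply: (k_weight_indep (V := V1) q0 qnr us) => [mu|].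
      by have [[]] := corr_wt (CX mu).
    by rewrite -fstE -eX.
  have /= -> := congr1 snd eX; rewrite sndE big1_seq // => mu /andP[_ /e10 e1].
  by apply: (corr_inj2 (mu := mu)); rewrite -e1 -surjective_pairing.
move=> x y Gxy.
apply: (gspan_map (g := id) (h := fun z : cV12 => (D1 *m z.1, D2 *m z.2))) Gxy.
- by rewrite !mulmx0.
- by move=> z w /=; rewrite !mulmxDr.
- exact: corr_D12.
Qed.

End Correspondence.

(** * Operations on isomorphism graphs, and equality of traces *)

Section IsoGraph.
Variables (F : fieldType) (N1 N2 : nat).
Implicit Types (U : {vspace 'cV[F]_N1}) (W : {vspace 'cV[F]_N2}).
Implicit Types (D X : 'M[F]_N1) (E Y : 'M[F]_N2).
Implicit Types G H : 'cV[F]_N1 * 'cV[F]_N2 -> Prop.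

Lemma iso_graph_eigen U W D E X Y G c : iso_graph U W D E G ->
  (forall x, x \in U -> X *m x = c *: x) ->
  (forall y, y \in W -> Y *m y = c *: y) ->
  iso_graph U W (D *m X) (E *m Y) G.
Proof.
case=> linG subG t1 t2 i1 i2 sG hX hY; split=> // x y Gxy.
have [xU yW] := subG _ _ Gxy.
rewrite -!mulmxA hX // hY // -!scalemxAr.
exact: (linZ linG c (sG _ _ Gxy)).
Qed.

(** Directness on each side keeps the sum injective: if the second coordinates of [a] and [b]
    cancel, they lie in [W :&: W'] and are 0, and likewise for the first. *)
Lemma iso_graph_add U U' W W' D E G H :
  iso_graph U W D E G -> iso_graph U' W' D E H ->
  (U :&: U' = 0)%VS -> (W :&: W' = 0)%VS ->
  iso_graph (U + U')%VS (W + W')%VS D E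
    (fun z => exists a b, [/\ G a, H b & z = a + b]).
Proof.
move=> GP HP UU' WW'; split.
- split=> [|_ _ [a [b [Ga Hb ->]]] [a' [b' [Ga' Hb' ->]]]|c _ [a [b [Ga Hb ->]]]].
  + exists 0, 0; split; rewrite ?addr0 //; first exact: lin0 (ig_lin GP).
    exact: lin0 (ig_lin HP).
  + exists (a + a'), (b + b'); rewrite addrACA; split=> //.
      exact: (linD (ig_lin GP)).
    exact: (linD (ig_lin HP)).
  + exists (c *: a), (c *: b); rewrite scalerDr; split=> //.
      exact: (linZ (ig_lin GP)).
    exact: (linZ (ig_lin HP)).
- move=> x y [[a1 a2] [[b1 b2] [/(ig_sub GP)[? ?] /(ig_sub HP)[? ?] [-> ->]]]].
  by split; apply: memv_add.
- move=> x /memv_addP[a aU [b bU' ->]].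
  have [a' Ga] := ig_total1 GP aU; have [b' Hb] := ig_total1 HP bU'.
  by exists (a' + b'), (a, a'), (b, b').
- move=> x /memv_addP[a aU [b bU' ->]].
  have [a' Ga] := ig_total2 GP aU; have [b' Hb] := ig_total2 HP bU'.
  by exists (a' + b'), (a', a), (b', b).
- move=> x [[a1 a2] [[b1 b2] [Ga Hb [-> /esym/eqP]]]].
  rewrite addr_eq0 => /eqP e2.
  have a20 : a2 = 0.
    apply/eqP; rewrite -memv0 -WW' memv_cap; have [_ ->] := ig_sub GP Ga.
    by rewrite e2 memvN; have [_ ->] := ig_sub HP Hb.
  have b20 : b2 = 0 by apply/eqP; rewrite -oppr_eq0 -e2 a20.
  by rewrite a20 in Ga; rewrite b20 in Hb;
    rewrite (ig_inj1 GP Ga) (ig_inj1 HP Hb) addr0.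
- move=> x [[a1 a2] [[b1 b2] [Ga Hb [/esym/eqP e ->]]]].
  move: e; rewrite addr_eq0 => /eqP e1.
  have a10 : a1 = 0.
    apply/eqP; rewrite -memv0 -UU' memv_cap; have [-> _] := ig_sub GP Ga.
    by rewrite e1 memvN; have [-> _] := ig_sub HP Hb.
  have b10 : b1 = 0 by apply/eqP; rewrite -oppr_eq0 -e1 a10.
  by rewrite a10 in Ga; rewrite b10 in Hb;
    rewrite (ig_inj2 GP Ga) (ig_inj2 HP Hb) addr0.
move=> x y [[a1 a2] [[b1 b2] [Ga Hb [-> ->]]]].
exists (D *m a1, E *m a2), (D *m b1, E *m b2); rewrite !mulmxDr.
by split=> //; [exact: (ig_stable GP) | exact: (ig_stable HP)].
Qed.

End IsoGraph.

Lemma eq_mulmx_cV (F : fieldType) (M N : nat) (A B : 'M[F]_(M, N)) :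
  (forall x : 'cV_N, A *m x = B *m x) -> A = B.
Proof.
move=> h; apply/matrixP => i j.
by have /colP/(_ i) := h (delta_mx j 0); rewrite -!colE !mxE.
Qed.

(** The graph is that of an invertible matrix [T] with [T *m D = E *m T], so [D] and [E] are
    conjugate. *)
Lemma iso_graph_trace (F : fieldType) (N : nat) (D E : 'M[F]_N)
    (G : 'cV[F]_N * 'cV[F]_N -> Prop) :
  iso_graph fullv fullv D E G -> \tr D = \tr E.
Proof.
case=> linG _ t1 t2 i1 i2 sG.
have G_inj x y y' : G (x, y) -> G (x, y') -> y = y'.
  move=> Gy Gy'; apply/eqP; rewrite -subr_eq0; apply/eqP/i2.
  by have := linB linG Gy Gy'; rewrite -[_ - _]/(x - x, y - y') subrr.
have G_inj' x x' y : G (x, y) -> G (x', y) -> x = x'.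
  move=> Gx Gx'; apply/eqP; rewrite -subr_eq0; apply/eqP/i1.
  by have := linB linG Gx Gx'; rewrite -[_ - _]/(x - x', y - y) subrr.
(* The columns are chosen images of the basis vectors; linearity of [H] extends the property to all
   vectors. *)
have mxP (H : 'cV[F]_N * 'cV[F]_N -> Prop) : lin_closed H ->
    (forall x, exists y, H (x, y)) -> exists T : 'M[F]_N, forall x, H (x, T *m x).
  move=> linH tH; pose h j := projT1 (cid (tH (delta_mx j 0))).
  exists (\matrix_(i, j) h j i 0) => x.
  have -> : (x, (\matrix_(i, j) h j i 0) *m x)
      = \sum_j x j 0 *: (delta_mx j 0 : 'cV[F]_N, h j).
    rewrite [RHS]surjective_pairing; congr (_, _).
      rewrite (big_morph fst (id1 := 0) (op1 := +%R)) // [LHS]matrix_sum_delta.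
      by apply: eq_bigr => i _; rewrite big_ord1.
    rewrite (big_morph snd (id1 := 0) (op1 := +%R)) //; apply/colP => i.
    rewrite !mxE summxE; apply: eq_bigr => j _; rewrite !mxE mulrC //.
  apply: (lin_sum (P := H)) => // j; apply: (linZ linH).
  exact: (projT2 (cid (tH (delta_mx j 0)))).
have [T hT] := mxP G linG (fun x => t1 x (memvf x)).
have [||S hS] := mxP (fun z => G (z.2, z.1)).
- split=> [|[? ?] [? ?]|c [? ?]]; [exact: lin0 linG|exact: linD|exact: linZ].
- by move=> y; have [x] := t2 y (memvf y); exists x.
have ST : S *m T = 1%:M.
  apply: eq_mulmx_cV => x; rewrite mul1mx -mulmxA.
  exact: G_inj' (hS _) (hT x).
have TD : T *m D = E *m T.
  apply: eq_mulmx_cV => x; rewrite -!mulmxA.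
  exact: G_inj (hT _) (sG _ _ (hT x)).
by rewrite -[D]mul1mx -ST -mulmxA TD mxtrace_mulC -mulmxA (mulmx1C ST) mulmx1.
Qed.

(** * Tensor products and tensor powers of matrices *)

Section Tensors.
Variable F : fieldType.

Lemma tensmxDl m n p q (A B : 'M[F]_(m, n)) (C : 'M[F]_(p, q)) :
  (A + B) *t C = A *t C + B *t C.
Proof. by apply/matrixP => i j; rewrite !mxE mulrDl. Qed.

Lemma tensmxDr m n p q (A B : 'M[F]_(p, q)) (C : 'M[F]_(m, n)) :
  C *t (A + B) = C *t A + C *t B.
Proof. by apply/matrixP => i j; rewrite !mxE mulrDr. Qed.

Lemma tensmxZl m n p q c (A : 'M[F]_(m, n)) (C : 'M[F]_(p, q)) :
  (c *: A) *t C = c *: (A *t C).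
Proof. by apply/matrixP => i j; rewrite !mxE mulrA. Qed.

Lemma tensmxZr m n p q c (A : 'M[F]_(m, n)) (C : 'M[F]_(p, q)) :
  A *t (c *: C) = c *: (A *t C).
Proof. by apply/matrixP => i j; rewrite !mxE mulrCA. Qed.

Lemma tensmx11 m n : (1%:M : 'M[F]_m) *t (1%:M : 'M[F]_n) = 1%:M.
Proof.
apply/matrixP => i j; case: (mxtens_indexP i) => a b.
case: (mxtens_indexP j) => c d; rewrite tensmxE !mxE.
by rewrite (can_eq (@mxtens_indexK _ _)) xpair_eqE -natrM mulnb.
Qed.

Lemma mxtrace_tens m n (A : 'M[F]_m) (B : 'M[F]_n) :
  \tr (A *t B) = \tr A * \tr B.
Proof.
by rewrite /mxtrace mulr_sum; apply: eq_bigr => i _; rewrite mxE.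
Qed.

Lemma tensmxA m n p (A : 'M[F]_m) (B : 'M[F]_n) (C : 'M[F]_p)
    (e : (m * n * p = m * (n * p))%N) :
  castmx (e, e) (A *t B *t C) = A *t (B *t C).
Proof.
apply/matrixP => i j; rewrite castmxE.
case: (mxtens_indexP i) => a i'; case: (mxtens_indexP i') => b c.
case: (mxtens_indexP j) => a' j'; case: (mxtens_indexP j') => b' c'.
have idx (x : 'I_m) (y : 'I_n) (z : 'I_p) :
    cast_ord (esym e) (mxtens_index (x, mxtens_index (y, z)))
      = mxtens_index (mxtens_index (x, y), z).
  by apply: val_inj => /=; rewrite mulnDl mulnA addnA.
by rewrite !idx !tensmxE mulrA.
Qed.

Lemma ntensmx_mul N (A B : 'M[F]_N) f : A ^t f *m B ^t f = (A *m B) ^t f.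
Proof.
case: f => [|f]; first by rewrite !ntensmx0 mulmx1.
elim: f => [|f IH]; first by rewrite !ntensmx1.
by rewrite !ntensmxSS tensmx_mul IH.
Qed.

Lemma mxtrace_ntens N (A : 'M[F]_N) f : \tr (A ^t f) = \tr A ^+ f.
Proof.
case: f => [|f]; first by rewrite ntensmx0 mxtrace1.
elim: f => [|f IH]; first by rewrite ntensmx1.
by rewrite ntensmxSS mxtrace_tens IH (exprS _ f.+1).
Qed.

Lemma tensmx_castl m m' p (e : m = m') (A : 'M[F]_m) (B : 'M[F]_p) :
  castmx (e, e) A *t B
    = castmx (congr1 (muln^~ p) e, congr1 (muln^~ p) e) (A *t B).
Proof. by case: m' / e; rewrite !castmx_id. Qed.

(** Regroups the tensor power along the block sizes of [local_mx] at the first position, so that the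
    trace factors there. *)
Lemma ntensmx_split N (A : 'M[F]_N) k f
    (e : (N ^ 0 * (N * N) * N ^ k = N ^ f)%N) : f = k.+2 ->
  castmx (e, e) ((1%:M : 'M_(N ^ 0)) *t (A *t A) *t A ^t k) = A ^t f.
Proof.
move=> ef; move: e; rewrite {f}ef => e.
have -> : (1%:M : 'M_(N ^ 0)) *t (A *t A)
    = castmx (esym (mul1n _), esym (mul1n _)) (A *t A) by exact: tens_scalar1mx.
case: k e => [|k] e.
  by rewrite ntensmx0 tens_mx_scalar scale1r !castmx_comp castmx_id.
rewrite tensmx_castl castmx_comp !ntensmxSS.
have eA : (N * N * N ^ k.+1 = N * (N * N ^ k.+1))%N by rewrite mulnA.
rewrite -(tensmxA A A _ eA).
by congr (castmx (_, _) _); apply: eq_irrelevance.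
Qed.

End Tensors.

(** * Tensor squares and link polynomials *)

Section TensorModule.
Variables (F : fieldType) (n : nat) (odd_idx : 'I_n -> bool) (p : F) (N : nat).
Variable V : gaction F n N.
Hypotheses (p0 : p != 0) (VP : weak_module odd_idx p V).
Local Notation wt := 'rV[int]_n.
Local Notation Gam := (parity_mx F (parity V)).
Local Notation VV := (tens_action odd_idx V V).

Let par (b : bool) : 'M[F]_N := if b then Gam else 1%:M.

Let super_tensE b (A B : 'M[F]_N) :
  super_tens (parity V) A b B = (A *m par b) *t B.
Proof. by case: b => //=; rewrite /super_tens /= mulmx1. Qed.

Lemma parity_mxK : Gam *m Gam = 1%:M.
Proof.
apply/matrixP => i j; rewrite mulmx_diag !mxE -signr_addb addbb.
by case: eqP => // _; rewrite mulr0n.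
Qed.

Let parM a b : par a *m par b = par b *m par a.
Proof. by case: a; case: b; rewrite /= ?mul1mx ?mulmx1. Qed.

Let parK b : par b *m par b = 1%:M.
Proof. by case: b; rewrite /= ?mul1mx ?parity_mxK. Qed.

Let par_act b x : par b *m V x = (-1) ^+ (b && gparity odd_idx x) *: (V x *m par b).
Proof.
case: b => /=; first exact: (wm_parity VP).
by rewrite mul1mx mulmx1 expr0 scale1r.
Qed.

Lemma parity_mx_tens :
  parity_mx F (tens_parity (parity V) (parity V)) = Gam *t Gam.
Proof.
apply/matrixP => i j; case: (mxtens_indexP i) => a b.
case: (mxtens_indexP j) => c d; rewrite tensmxE !mxE.
rewrite (can_eq (@mxtens_indexK _ _)) xpair_eqE /tens_parity mxtens_indexK /=.
by case: eqP; case: eqP => _ _; rewrite ?mulr1n ?mulr0n ?mulr0 ?mul0r // signr_addb.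
Qed.

Let KV_comm i x : V (gKV i) *m x = x *m V (gKV i)
  <-> V (gK i) *m x = x *m V (gK i).
Proof.
split=> h.
  rewrite -[x in RHS]mul1mx -(wm_KKV VP i) -!mulmxA (mulmxA (V (gKV i))) h.
  by rewrite -!mulmxA (wm_KVK VP) mulmx1.
rewrite -[x in RHS]mul1mx -(wm_KVK VP i) -!mulmxA (mulmxA (V (gK i))) h.
by rewrite -!mulmxA (wm_KKV VP) mulmx1.
Qed.

Let KVE i j : V (gKV i) *m V (gE j)
  = p ^ (- dot (alpha i) (alpha j)) *: (V (gE j) *m V (gKV i)).
Proof.
have d0 := expfz_neq0 (dot (alpha i) (alpha j)) p0.
have e : V (gE j) *m V (gK i)
    = p ^ (- dot (alpha i) (alpha j)) *: (V (gK i) *m V (gE j)).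
  by rewrite (wm_KE VP) scalerA -invr_expz mulVf // scale1r.
rewrite -[LHS]mulmx1 -(wm_KKV VP i) mulmxA -(mulmxA (V (gKV i))) e.
by rewrite -scalemxAr -scalemxAl mulmxA (wm_KVK VP) mul1mx.
Qed.

Let KE_tens i j : (V (gK i) *t V (gK i)) *m coproduct odd_idx V V (gE j)
  = p ^ dot (alpha i) (alpha j) *:
      (coproduct odd_idx V V (gE j) *m (V (gK i) *t V (gK i))).
Proof.
rewrite /= !super_tensE mulmxDr mulmxDl !tensmx_mul !mulmx1 mul1mx.
have := par_act (odd_idx j) (gK i); rewrite /= andbF expr0 scale1r => ->.
rewrite !(wm_KE VP) (wm_KK VP i j) tensmxZl tensmxZr scalerDr //.
Qed.

Let KF_tens i j : (V (gK i) *t V (gK i)) *m coproduct odd_idx V V (gF j)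
  = p ^ (- dot (alpha i) (alpha j)) *:
      (coproduct odd_idx V V (gF j) *m (V (gK i) *t V (gK i))).
Proof.
rewrite /= !super_tensE mulmxDr mulmxDl !tensmx_mul !mulmx1 mul1mx.
have := par_act (odd_idx j) (gK i); rewrite /= andbF expr0 scale1r => e.
have := (KV_comm j (V (gK i))).2 (wm_KK VP j i) => ek.
have -> : V (gKV j) *m par (odd_idx j) *m V (gK i)
    = V (gK i) *m (V (gKV j) *m par (odd_idx j)).
  by rewrite -mulmxA e mulmxA ek mulmxA.
by rewrite !(wm_KF VP) tensmxZl tensmxZr scalerDr.
Qed.

(** The mixed terms cancel, leaving the commutator tensored with [K] and [KV] tensored with the
    commutator; for i = j these telescope to [K *t K - KV *t KV]. *)
Let EF_tens i j : coproduct odd_idx V V (gE i) *m coproduct odd_idx V V (gF j)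
   - (-1) ^+ (odd_idx i && odd_idx j) *:
       (coproduct odd_idx V V (gF j) *m coproduct odd_idx V V (gE i))
  = if i == j then (p - p^-1)^-1 *:
      (V (gK i) *t V (gK i) - V (gKV i) *t V (gKV i)) else 0.
Proof.
rewrite /= !super_tensE.
set ij := odd_idx i && odd_idx j; set eps := (-1) ^+ ij : F.
have eps2 : eps * eps = 1 by rewrite -signr_addb addbb.
set E := V (gE i); set Fj := V (gF j); set K := V (gK i); set KV := V (gKV j).
set gi := par (odd_idx i); set gj := par (odd_idx j).
have giF : gi *m Fj = eps *: (Fj *m gi) by exact: par_act.
have gjE : gj *m E = eps *: (E *m gj).
  by rewrite /gj /E par_act /= andbC.
have giKV : gi *m KV = KV *m gi.
  by have := par_act (odd_idx i) (gKV j); rewrite /= andbF expr0 scale1r.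
have KF := wm_KF VP i j; rewrite -/K -/Fj in KF.
have KVEj := KVE j i; rewrite -/KV -/E dotC in KVEj.
rewrite !mulmx1 !mul1mx !mulmxDl !mulmxDr !tensmx_mul !mulmx1 !mul1mx.
set d := p ^ (- dot (alpha i) (alpha j)) in KF KVEj.
(* The factor [d] from moving [K] past [Fj] is absorbed in moving [E] past [KV]. *)
have e1 : (E *m (KV *m gj)) *t (K *m Fj) = eps *: ((KV *m gj *m E) *t (Fj *m K)).
  rewrite KF -(mulmxA KV) gjE -scalemxAr tensmxZl scalerA eps2 scale1r !mulmxA.
  by rewrite KVEj -scalemxAl tensmxZl tensmxZr.
have e2 : (gi *m Fj) *t E = eps *: ((Fj *m gi) *t E) by rewrite giF tensmxZl.
have e3 : gi *m (KV *m gj) = KV *m gj *m gi.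
  by rewrite mulmxA giKV -!mulmxA parM.
rewrite e1 e2 e3 !scalerDr.
set a1 := (E *m Fj) *t K; set a2 := eps *: (_ *t (Fj *m K)).
set a3 := eps *: (_ *t E); set a4 := _ *t (E *m Fj).
set b1 := eps *: (_ *t K); set b4 := eps *: (_ *t (Fj *m E)).
have -> : a1 + a2 + (a3 + a4) - (b1 + a3 + (a2 + b4)) = (a1 - b1) + (a4 - b4).
  rewrite (addrACA b1) opprD addrACA (addrC a3 a4) (addrC a3 b4).
  by congr (_ + _); rewrite opprD addrACA subrr addr0.
rewrite {}/a1 {}/a4 {}/b1 {}/b4 -tensmxZl -tensmxZr.
have tB m1 (A B : 'M[F]_N) (C : 'M[F]_m1) : A *t C - B *t C = (A - B) *t C.
  by rewrite -[in RHS]scaleN1r tensmxDl tensmxZl scaleN1r.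
have tBr m1 (A B : 'M[F]_N) (C : 'M[F]_m1) : C *t A - C *t B = C *t (A - B).
  by rewrite -[in RHS]scaleN1r tensmxDr tensmxZr scaleN1r.
rewrite tB.
have -> : KV *m gj *m gi = KV *m gi *m gj by rewrite -!mulmxA parM.
rewrite tBr (wm_EF VP).
have [eij|_] := eqVneq i j; last by rewrite tens0mx tensmx0 addr0.
rewrite tensmxZl tensmxZr /= -mulmxA /gi /gj eij parK mulmx1 /K /KV eij.
by rewrite -tB -tBr -!scalerDr addrA subrK.
Qed.

Lemma tens_weak_module : weak_module odd_idx p VV.
Proof.
split.
- move=> x; rewrite /= parity_mx_tens.
  have G0 y : Gam *m V y = (-1) ^+ gparity odd_idx y *: (V y *m Gam).
    exact: wm_parity VP y.
  have Gp b : Gam *m par b = par b *m Gam by exact: (parM true b).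
  case: x => i; rewrite /= ?super_tensE /=.
  + rewrite mulmxDr mulmxDl !tensmx_mul !mulmx1 !mul1mx Gp !G0 /= !expr0 !scale1r.
    by rewrite tensmxZl tensmxZr scalerDr.
  + rewrite mulmxDr mulmxDl !tensmx_mul !mulmx1 !mul1mx !mulmxA !G0 /=.
    rewrite !expr0 !scale1r.
    by rewrite -!mulmxA Gp tensmxZl tensmxZr scalerDr.
  + by rewrite expr0 scale1r !tensmx_mul !mulmx1 !G0 expr0 !scale1r.
  + by rewrite expr0 scale1r !tensmx_mul !mulmx1 !G0 expr0 !scale1r.
- by move=> i j; rewrite /= /super_tens !tensmx_mul !(wm_KK VP i j).
- by move=> i; rewrite /= /super_tens tensmx_mul (wm_KKV VP) tensmx11.
- by move=> i; rewrite /= /super_tens tensmx_mul (wm_KVK VP) tensmx11.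
- exact: KE_tens.
- exact: KF_tens.
- exact: EF_tens.
Qed.

Lemma k_two_rho_tens : k_two_rho VV = k_two_rho V *t k_two_rho V.
Proof.
rewrite /k_two_rho; have tX i (k : nat) :
    (VV (gK i) ^+ k : 'M_(N * N)) = (V (gK i) ^+ k : 'M_N) *t (V (gK i) ^+ k).
  elim: k => [|k IH]; first by rewrite !expr0 [RHS]tensmx11.
  by rewrite !exprS IH [LHS]tensmx_mul.
elim/big_rec2: _ => [|i A B _ ->]; first by rewrite [RHS]tensmx11.
by rewrite tX [LHS]tensmx_mul.
Qed.

Lemma tens_D : (Gam *m k_two_rho V) *t (Gam *m k_two_rho V)
  = parity_mx F (parity VV) *m k_two_rho VV.
Proof. by rewrite k_two_rho_tens parity_mx_tens tensmx_mul. Qed.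

Variable ep : F.
Hypothesis ep0 : ep != 0.

Lemma is_wt_tens mu nu (x y : 'cV[F]_N) :
  is_wt p ep V mu x -> is_wt p ep V nu y ->
  is_wt p ep VV (mu + nu) (x *t y : 'cV_(N * N)).
Proof.
have mulTV (A B : 'M[F]_N) : (A *t B) *m (x *t y : 'cV_(N * N))
  = ((A *m x) *t (B *m y) : 'cV_(N * N)) by exact (tensmx_mul A B x y).
move=> [kx px] [ky py]; split=> [i|].
  rewrite /= /super_tens mulTV kx ky tensmxZl tensmxZr scalerA.
  by rewrite dotDr expfzDr.
rewrite parity_mx_tens mulTV px py tensmxZl tensmxZr scalerA.
by rewrite wsumD expfzDr.
Qed.

(** Tensors of weight vectors are weight vectors, and each basis vector of the square is a tensor of
    basis vectors. *)
Lemma gspan_wt_tens : (forall x, gspan (is_wt p ep V) x) ->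
  forall z, gspan (is_wt p ep VV) z.
Proof.
move=> spanV z; have linG := gspan_lin (is_wt_graded p ep VV).
have spanT1 mu (x y : 'cV[F]_N) : is_wt p ep V mu x ->
    gspan (is_wt p ep VV) (x *t y : 'cV_(N * N)).
  move=> wx; elim: (spanV y) => [|nu y1 y2 wy _ IH].
    by rewrite tensmx0; apply: gspan0.
  rewrite tensmxDr; apply: (linD linG) => //.
  by apply: gspan_in; apply: is_wt_tens wx wy.
have spanT (x y : 'cV[F]_N) : gspan (is_wt p ep VV) (x *t y : 'cV_(N * N)).
  elim: (spanV x) => [|mu x1 x2 wx _ IH]; first by rewrite tens0mx; apply: gspan0.
  by rewrite tensmxDl; apply: (linD linG) => //; apply: spanT1 wx.
have -> : z = \sum_k z k 0 *: (delta_mx k 0 : 'cV_(N * N)).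
  by rewrite [LHS]matrix_sum_delta; apply: eq_bigr => k _; rewrite big_ord1.
apply: (lin_sum (P := gspan (is_wt p ep VV))) => // k; apply: (linZ linG).
suff -> : (delta_mx k 0 : 'cV[F]_(N * N))
    = ((delta_mx (mxtens_unindex k).1 0 : 'cV[F]_N)
         *t (delta_mx (mxtens_unindex k).2 0 : 'cV[F]_N)) by exact: spanT.
apply/matrixP => i j; rewrite !mxE.
case: (mxtens_indexP i) => a b; case: (mxtens_indexP k) => c d.
rewrite !mxtens_indexK (can_eq (@mxtens_indexK _ _)) xpair_eqE /=.
by rewrite !ord1 !eqxx !andbT -natrM mulnb.
Qed.

End TensorModule.

(** * Twisted traces of powers of the first braid generator *)

Section LinkTrace.
Variables (F : fieldType) (n N f : nat).
Hypothesis hf : (1 < f)%N.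

Lemma local_mx_mul (X Y : 'M[F]_(N * N)) (i : 'I_f.-1) :
  local_mx X i *m local_mx Y i = local_mx (X *m Y) i.
Proof.
rewrite /local_mx; move: (dim_split N i); move: (N ^ f)%N => M e.
by case: M / e; rewrite !castmx_id !tensmx_mul !mulmx1.
Qed.

Lemma local_mx_exp (X : 'M[F]_(N * N)) (i : 'I_f.-1) k :
  (local_mx X i : 'M_(N ^ f)) ^+ k = local_mx (X ^+ k) i.
Proof.
elim: k => [|k IH].
  rewrite !expr0 /local_mx (_ : (1 : 'M[F]_(N * N)) = 1%:M) // !tensmx11.
  by move: (dim_split N i); move: (N ^ f)%N => M e; case: M / e; rewrite castmx_id.
by rewrite !exprS IH [LHS]local_mx_mul.
Qed.

(** Each of the [f - 2] strands on which the generator acts trivially splits off a factor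
    [\tr A]. *)
Lemma mxtrace_local_mx (A : 'M[F]_N) (X : 'M[F]_(N * N)) :
  \tr (A ^t f *m local_mx X (sigma1 hf))
    = \tr ((A *t A) *m X) * \tr A ^+ (f - 2).
Proof.
have f2 : f = (f - 2).+2 by move: hf; lia.
rewrite -(ntensmx_split A (dim_split N (sigma1 hf)) f2) /local_mx.
move: (dim_split N (sigma1 hf)); move: (N ^ f)%N => M e.
case: M / e; rewrite !castmx_id !tensmx_mul !mulmx1 !mxtrace_tens.
by rewrite mxtrace1 mul1r mxtrace_ntens.
Qed.

Lemma braid_mx_sigma1_pow (X : 'M[F]_(N * N)) (m : int) :
  braid_mx X (sigma1_pow hf m)
    = local_mx ((if m < 0 then invmx X else X) ^+ `|m|%N) (sigma1 hf).
Proof.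
by rewrite /braid_mx braid_image_sigma1_pow -local_mx_exp; case: ifP.
Qed.

Lemma str_q_sigma1_pow (V : gaction F n N) (X : 'M[F]_(N * N)) (m : int) :
  str_q V (braid_mx X (sigma1_pow hf m))
    = \tr (((parity_mx F (parity V) *m k_two_rho V)
             *t (parity_mx F (parity V) *m k_two_rho V))
             *m ((if m < 0 then invmx X else X) ^+ `|m|%N))
      * \tr (parity_mx F (parity V) *m k_two_rho V) ^+ (f - 2).
Proof.
by rewrite /str_q braid_mx_sigma1_pow ntensmx_mul mxtrace_local_mx.
Qed.

Lemma parity_mx_even (par : 'I_N -> bool) :
  (forall a, par a = false) -> parity_mx F par = 1%:M.
Proof.
move=> h; rewrite /parity_mx -[RHS]diag_const_mx; congr diag_mx.
by apply/rowP => a; rewrite !mxE h expr0.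
Qed.

Lemma ntensmx1 k : (1%:M : 'M[F]_N) ^t k = 1%:M.
Proof.
case: k => [|k]; first by rewrite ntensmx0.
by elim: k => // k IH; rewrite ntensmxSS IH tensmx11.
Qed.

(** Lets [str_q_sigma1_pow] serve both algebras. *)
Lemma tr_q_str_q (V : gaction F n N) (X : 'M[F]_(N ^ f)) :
  (forall a, parity V a = false) -> tr_q V X = str_q V X.
Proof.
by move=> h; rewrite /tr_q /str_q parity_mx_even // ntensmx1 mul1mx.
Qed.

End LinkTrace.

(** * Integer powers of an operator with known spectrum *)

Section Spectrum.
Variables (F : fieldType) (N : nat).

Lemma surj_unitmx (X : 'M[F]_N) :
  (forall y : 'cV_N, exists x, X *m x = y) -> X \in unitmx.
Proof.
move=> h; have [S hS] : exists S : 'I_N -> 'cV[F]_N,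
    forall j, X *m S j = delta_mx j 0.
  by exists (fun j => projT1 (cid (h (delta_mx j 0)))) => j; case: cid.
suff /mulmx1_unit[] : X *m \matrix_(i, j) S j i 0 = 1%:M by [].
apply/matrixP => i j; have /colP/(_ i) := hS j.
rewrite !mxE eqxx andbT => <-.
by apply: eq_bigr => k _; rewrite mxE.
Qed.

Lemma pow_eigen (X : 'M[F]_N) (c : F) (v : 'cV_N) (m : int) :
  X \in unitmx -> c != 0 -> X *m v = c *: v ->
  ((if m < 0 then invmx X else X) ^+ `|m|%N : 'M_N) *m v
    = (if m < 0 then c^-1 else c) ^+ `|m|%N *: v.
Proof.
move=> uX c0 Xv; set Y := if _ then _ else _; set d := if _ then _ else _.
have Yv : Y *m v = d *: v.
  rewrite /Y /d; case: ifP => // _.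
  by rewrite -[LHS](scalerK c0) scalemxAr -Xv mulKmx.
elim: `|m|%N => [|k IH]; first by rewrite !expr0 mul1mx scale1r.
by rewrite !exprS -[_ * _ in LHS]/(_ *m _) -mulmxA IH -scalemxAr Yv scalerA mulrC.
Qed.

(** For negative exponents: [invmx] is an inverse only of a unit matrix. A preimage is found by
    dividing each component by its eigenvalue. *)
Lemma spectrum_unitmx (X : 'M[F]_N) (U1 U2 U3 : {vspace 'cV[F]_N}) (a b c : F) :
  (U1 + U2 + U3)%VS = fullv -> a != 0 -> b != 0 -> c != 0 ->
  (forall v, v \in U1 -> X *m v = a *: v) ->
  (forall v, v \in U2 -> X *m v = b *: v) ->
  (forall v, v \in U3 -> X *m v = c *: v) -> X \in unitmx.
Proof.
move=> U a0 b0 c0 h1 h2 h3; apply: surj_unitmx => y.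
have := memvf y; rewrite -U.
case/memv_addP => _ /memv_addP[y1 y1U [y2 y2U ->]] [y3 y3U ->].
exists (a^-1 *: y1 + b^-1 *: y2 + c^-1 *: y3).
rewrite !mulmxDr -!scalemxAr h1 // h2 // h3 //.
by rewrite !scalerA !mulVf // !scale1r.
Qed.

End Spectrum.

(** * Comparison of the two link polynomials *)

Section Comparison.
Variables (F : fieldType) (n : nat) (q : F).
Hypotheses (n0 : (0 < n)%N) (q0 : q != 0).
Hypothesis qnr : forall k : nat, (0 < k)%N -> q ^+ k != 1.
Local Notation D V := (parity_mx F (parity V) *m k_two_rho V).

Let ep10 : (-1 : F) != 0. Proof. by rewrite oppr_eq0 oner_eq0. Qed.
Let opp_q0 : - q != 0. Proof. by rewrite oppr_eq0. Qed.

Lemma irreducible_hw_iso_graph (N1 N2 : nat) (V1 : gaction F n N1)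
    (V2 : gaction F n N2) (lambda : 'rV[int]_n)
    (U1 : {vspace 'cV[F]_N1}) (U2 : {vspace 'cV[F]_N2}) :
  weak_module (@osp_odd n) q V1 -> weak_module (@so_odd n) (- q) V2 ->
  (forall v, k_weight q V1 lambda v -> is_wt q (-1) V1 lambda v) ->
  (forall v, k_weight (- q) V2 lambda v -> is_wt (- q) 1 V2 lambda v) ->
  irreducible_hw V1 q lambda U1 -> irreducible_hw V2 (- q) lambda U2 ->
  exists G, iso_graph U1 U2 (D V1) (D V2) G.
Proof.
move=> V1P V2P wt1 wt2 [irr1 [v1 v1U [v10 v1E v1K]]] [irr2 [v2 v2U [v20 v2E v2K]]].
eexists; apply: (gspan_corr_iso_graph q0 qnr V1P V2P irr1 irr2 v1U v2U) => //.
- exact: wt1.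
- exact: wt2.
Qed.

Variables (V W : gaction F n n.*2.+1).
Hypotheses (VP : osp_vector_module q V) (WP : so_vector_module (- q) W).

Let V_weak : weak_module (@osp_odd n) q V.
Proof. by case: VP => /module_weak. Qed.

Let W_weak : weak_module (@so_odd n) (- q) W.
Proof. by case: WP => /module_weak. Qed.

Let W_even a : parity W a = false.
Proof. by case: WP. Qed.

(** An odd highest weight vector fits the parity rule, as epsilon_1 has coordinate sum 1. *)
Let V_hw : exists2 v, is_wt q (-1) V (eps n 0) v
  & highest_weight_vector V q (eps n 0) v.
Proof.
have [_ _ [v hv pv]] := VP; exists v => //; split; first by case: hv.
by rewrite pv wsum_eps n0 scaleN1r.
Qed.

Let W_hw : exists2 v, is_wt (- q) 1 W (eps n 0) v
  & highest_weight_vector W (- q) (eps n 0) v.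
Proof.
have [_ _ _ [v hv]] := WP; exists v => //; split; first by case: hv.
by rewrite parity_mx_even // mul1mx exp1rz scale1r.
Qed.

Let V_span x : gspan (is_wt q (-1) V) x.
Proof.
have [v wv [v0 _ _]] := V_hw; have [_ irrV _] := VP.
exact: (is_wt_gspan q0 ep10 (@osp_ep_alpha F n) V_weak irrV _ v0 wv).
Qed.

Let W_span x : gspan (is_wt (- q) 1 W) x.
Proof.
have [v wv [v0 _ _]] := W_hw; have [_ _ irrW _] := WP.
exact: (is_wt_gspan opp_q0 (oner_neq0 _) (@so_ep_alpha F n) W_weak irrW _ v0 wv).
Qed.

Lemma sdim_eq : \tr (D V) = \tr (D W).
Proof.
have [v _ hv] := V_hw; have [w _ hw] := W_hw.
have [_ irrV _] := VP; have [_ _ irrW _] := WP.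
have [G GP] : exists G, iso_graph fullv fullv (D V) (D W) G.
  apply: (irreducible_hw_iso_graph (lambda := eps n 0) V_weak W_weak).
  - by move=> x; apply: (k_weight_is_wt q0 qnr).
  - by move=> x; apply: (k_weight_is_wt opp_q0 (nonroot_opp qnr)).
  - by split=> //; exists v; rewrite ?memvf.
  - by split=> //; exists w; rewrite ?memvf.
exact: iso_graph_trace GP.
Qed.

Lemma tens_iso_graph (lambda : 'rV[int]_n)
    (U1 U2 : {vspace 'cV[F]_(n.*2.+1 * n.*2.+1)}) :
  irreducible_hw (tens_action (@osp_odd n) V V) q lambda U1 ->
  irreducible_hw (tens_action (@so_odd n) W W) (- q) lambda U2 ->
  exists G, iso_graph U1 U2 ((D V) *t (D V)) ((D W) *t (D W)) G.
Proof.
move=> h1 h2; rewrite (tens_D (@osp_odd n)) (tens_D (@so_odd n)).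
apply: (irreducible_hw_iso_graph _ _ _ _ h1 h2).
- exact: tens_weak_module.
- exact: tens_weak_module.
- by move=> x; apply: (k_weight_is_wt q0 qnr); apply: gspan_wt_tens.
- move=> x; apply: (k_weight_is_wt opp_q0 (nonroot_opp qnr)).
  by apply: gspan_wt_tens; rewrite ?oner_eq0.
Qed.

Lemma Phi_osp_so_sigma1_pow (f : nat) (hf : (1 < f)%N) (m : int)
    (RV RW : 'M[F]_(n.*2.+1 * n.*2.+1)) :
  is_R_matrix (@osp_odd n) q q V RV -> is_R_matrix (@so_odd n) (- q) q W RW ->
  Phi_osp q V RV (sigma1_pow hf m) = Phi_so q W RW (sigma1_pow hf m).
Proof.
move=> [_ [V2 [Vm [V0 [[V2h Vmh V0h] Vfull Vdir [V2e Vme V0e]]]]]].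
move=> [_ [W2 [Wm [W0 [[W2h Wmh W0h] Wfull Wdir [W2e Wme W0e]]]]]].
rewrite /Phi_osp /Phi_so /link_polynomial tr_q_str_q // !str_q_sigma1_pow sdim_eq.
(* Normalisation and the remaining [f - 2] strands give equal factors; what is left is the twisted
   trace on two strands. *)
congr (_ * (_ * _ / _)).
set XV := Rcheck V RV in V2e Vme V0e *; set XW := Rcheck W RW in W2e Wme W0e *.
have qV0 : q^-1 != 0 by rewrite invr_neq0.
have q2n0 : q ^- (2 * n) != 0 by rewrite invr_neq0 ?expf_neq0.
have uV : XV \in unitmx by exact: (spectrum_unitmx Vfull opp_q0 qV0 q2n0).
have uW : XW \in unitmx by exact: (spectrum_unitmx Wfull opp_q0 qV0 q2n0).
set YV := _ ^+ _; set YW := (if _ then _ else XW) ^+ _.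
have [G2 G2P] := tens_iso_graph V2h W2h.
have [Gm GmP] := tens_iso_graph Vmh Wmh.
have [G0 G0P] := tens_iso_graph V0h W0h.
(* On matching components the [m]-th powers of both braid operators act by the same scalar, so each
   graph also intertwines the products with them. *)
have {}G2P := iso_graph_eigen G2P
  (fun x xU => pow_eigen m uV opp_q0 (V2e x xU))
  (fun x xU => pow_eigen m uW opp_q0 (W2e x xU)).
have {}GmP := iso_graph_eigen GmP
  (fun x xU => pow_eigen m uV qV0 (Vme x xU))
  (fun x xU => pow_eigen m uW qV0 (Wme x xU)).
have {}G0P := iso_graph_eigen G0P
  (fun x xU => pow_eigen m uV q2n0 (V0e x xU))
  (fun x xU => pow_eigen m uW q2n0 (W0e x xU)).
move: Vdir Wdir; rewrite !directv_addE => /and3P[/and3P[_ _ /eqP Vd1] _ /eqP Vd2].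
move=> /and3P[/and3P[_ _ /eqP Wd1] _ /eqP Wd2].
(* The three graphs are glued into one over the whole tensor squares, where it equates the
   traces. *)
have := iso_graph_add (iso_graph_add G2P GmP Vd1 Wd1) G0P Vd2 Wd2.
rewrite Vfull Wfull; exact: iso_graph_trace.
Qed.

End Comparison.

Theorem theorem1p2 (R : realType) (f : nat) (hf : (1 < f)%N) (m : int) :
  (forall tr : {scalar BWM R f}, is_bwm_trace tr ->
     neg_params (kauffman hf tr (sigma1_pow hf m))
       = kauffman hf tr (sigma1_pow hf m))
  /\
  (forall (n : nat) (q : R[i]),
     (0 < n)%N -> q != 0 -> (forall k : nat, (0 < k)%N -> q ^+ k != 1) ->
   forall (V W : gaction R[i] n n.*2.+1)
     (RV RW : 'M[R[i]]_(n.*2.+1 * n.*2.+1)),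
     osp_vector_module q V -> is_R_matrix (@osp_odd n) q q V RV ->
     so_vector_module (- q) W -> is_R_matrix (@so_odd n) (- q) q W RW ->
     Phi_osp q V RV (sigma1_pow hf m) = Phi_so q W RW (sigma1_pow hf m)).
Proof.
split=> [tr|n q n0 q0 qnr V W RV RW VP RVP WP RWP].
  exact: kauffman_sigma1_neg.
exact: Phi_osp_so_sigma1_pow RVP RWP.
Qed.
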